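(* Let $\omega:\mathbb{R}\to\mathbb{R}$ satisfy: (i) $\omega$ even; (ii) $\omega(x)\to0$ as $|x|\to\infty$ and $|\omega(x)|\le C(1+|x|)^{-1-\delta}$ for constants $C,\delta>0$; (iii) $\omega$ bounded, Lipschitz continuous and integrable; (iv) $\int_{\mathbb{R}}\omega>0$. Let $h\in\mathbb{R}$, $T>0$, and let $u_p$ be a regular 1-bump periodic solution with period $T$ of $u(x)=\int_{\mathbb{R}}\omega(x-y)H(u(y)-h)\,dy$ with $u_p(\pm a)=h$, $0<a<T/2$. Let $L:\ell^2_\infty(\mathbb{Z})\to\ell^2_\infty(\mathbb{Z})$ be the block Laurent operator $(L\mathrm{x})_i=\sum_jA_{i-j}\mathrm{x}_j$ with $A_k=\frac{1}{|u_p'(a)|}\begin{pmatrix}\omega(kT)&\omega(-2a+kT)\\ \omega(2a+kT)&\omega(kT)\end{pmatrix}$. For $q=1,2,\dots$ let $L(1+q)$ be the $2(1+q)\times2(1+q)$ block circulant matrix $$L(1+q)=\begin{pmatrix}B_0&B_1&B_2&\cdots&B_q\\ B_q&B_0&B_1&\cdots&B_{q-1}\\ \vdots&&&&\vdots\\ B_1&B_2&B_3&\cdots&B_0\end{pmatrix},\quad B_n=\frac{1}{|u_p'(a)|}\begin{pmatrix}\omega_p(nT;(1+q)T)&\omega_p(-2a+nT;(1+q)T)\\ \omega_p(2a+nT;(1+q)T)&\omega_p(nT;(1+q)T)\end{pmatrix},$$ $n=0,\dots,q$, where $\omega_p(x;P)=\sum_{k\in\mathbb{Z}}\omega(x-kP)$.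 Then $$\sigma(L)=\operatorname{cl}\Big(\bigcup_{q\ge1}\sigma\big(L(1+q)\big)\Big).$$
   Context: $H$ is the unit step function. A continuous $T$-periodic function $u$ is regular 1-bump periodic (threshold $h$) if it is bounded with bounded continuous derivative and a translate $p$ satisfies $p(\pm a)=h$, $p>h$ on $(-a,a)$, $p<h$ on $[-T/2,T/2]\setminus[-a,a]$, $p'(\pm a)\neq0$. $\ell^2_\infty(\mathbb{Z})$ is the space of bounded two-sided sequences with entries in $\mathbb{C}^2$ with the sup norm; $\sigma$ denotes spectrum and $\operatorname{cl}$ closure in $\mathbb{C}$. *)

(* Defs.v *)
From Stdlib Require Import Reals Lra ZArith.
From Coquelicot Require Import Coquelicot.
Open Scope R_scope.

(* Unit step function, convention H(0) = 0 (irrelevant up to null sets). *)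
Definition H (s : R) : R := if Rlt_dec 0 s then 1 else 0.

Definition Zsum (f : Z -> R) : R :=
  Series (fun n => f (Z.of_nat n)) + Series (fun n => f (- Z.of_nat (S n))%Z).

Definition CZsum (f : Z -> C) : C := (Zsum (fun k => fst (f k)), Zsum (fun k => snd (f k))).

Definition omega_p (omega : R -> R) (x P : R) : R := Zsum (fun k => omega (x - IZR k * P)).

Definition blk (f : R -> R) (c a s : R) (x : C * C) : C * C :=
  (Cplus (Cmult (RtoC (f s / c)) (fst x)) (Cmult (RtoC (f (-2 * a + s) / c)) (snd x)),
   Cplus (Cmult (RtoC (f (2 * a + s) / c)) (fst x)) (Cmult (RtoC (f s / c)) (snd x))).

Definition bdd_seq (x : Z -> C * C) : Prop :=
  exists M : R, forall i : Z, Cmod (fst (x i)) <= M /\ Cmod (snd (x i)) <= M.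

Definition Lop (omega : R -> R) (T a c : R) (x : Z -> C * C) (i : Z) : C * C :=
  (CZsum (fun j => fst (blk omega c a (IZR (i - j) * T) (x j))),
   CZsum (fun j => snd (blk omega c a (IZR (i - j) * T) (x j)))).

Definition vsub (x y : C * C) : C * C := (Cminus (fst x) (fst y), Cminus (snd x) (snd y)).
Definition vscal (l : C) (x : C * C) : C * C := (Cmult l (fst x), Cmult l (snd x)).
Definition vadd (x y : C * C) : C * C := (Cplus (fst x) (fst y), Cplus (snd x) (snd y)).

Definition in_spectrum_L (omega : R -> R) (T a c : R) (lam : C) : Prop :=
  ~ (forall y : Z -> C * C, bdd_seq y ->
       exists! x : Z -> C * C, bdd_seq x /\
         (forall i : Z, vsub (Lop omega T a c x i) (vscal lam (x i)) = y i)).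

Fixpoint vsum (n : nat) (f : nat -> C * C) : C * C :=
  match n with
  | O => (RtoC 0, RtoC 0)
  | S m => vadd (vsum m f) (f m)
  end.

(* The block circulant matrix L(1+q) applied to v : C^{2(1+q)} (v given block-wise,
   blocks indexed by 0..q):  block row r, block column c holds B_{(c - r) mod (1+q)},
   B_n = (1/cc) [[w(nT), w(-2a+nT)], [w(2a+nT), w(nT)]],  w = omega_p(. ; (1+q)T). *)
Definition circ_apply (omega : R -> R) (T a cc : R) (q : nat) (v : nat -> C * C) (r : nat)
  : C * C :=
  vsum (S q) (fun col =>
    blk (fun x => omega_p omega x (INR (S q) * T)) cc a
        (INR ((col + S q - r) mod (S q)) * T) (v col)).

Definition in_spectrum_circ (omega : R -> R) (T a cc : R) (q : nat) (lam : C) : Prop :=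
  exists v : nat -> C * C,
    (exists r, (r < S q)%nat /\ v r <> (RtoC 0, RtoC 0)) /\
    (forall r, (r < S q)%nat -> circ_apply omega T a cc q v r = vscal lam (v r)).

(* Main.v *)
(* A bounded translation-invariant operator acts on a character e_t(k) = exp(ikt) as a scalar,
   its symbol at t, so on vector-valued characters L acts as a two by two matrix Phi(t), and
   L(1+q) is diagonalised by the discrete Fourier transform into the matrices Phi(-2 pi j/(1+q)).
   If lam is a limit of eigenvalues of circulants, then the continuous function
   det (Phi(t) - lam) has infimum 0, hence a zero t, and L - lam has a kernel vector e_t w.
   If lam stays at distance eps from these eigenvalues, then det (Phi(t) - lam) is at least
   eps^2 in modulus at all roots of unity, and a quantitative form of Wiener's lemma makes the
   scalar operator det (L - lam) bijective; multiplying by the adjugate inverts L - lam. *)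
Require Import Defs.
From Stdlib Require Import Reals ZArith Lra Lia FunctionalExtensionality Classical.
From Coquelicot Require Import Coquelicot.
Open Scope R_scope.

(** * Finite sums of complex numbers *)

(** The obstacle is the sup norm: on bounded sequences the norm of a convolution is the absolute sum
    of its coefficients, which a bound on the symbol does not control in general. For a finite band
    it does, at the cost of a factor linear in the bandwidth, and the proof recovers the
    coefficients from samples at roots of unity, which is exactly what the circulants provide. The
    bandwidth of a power grows only linearly, so a geometric decay of the symbol wins. The bound
    [eps^2] comes from a factorisation: the diagonal entries of [Phi] are equal, so its eigenvalues
    are [A + z] and [A - z], with [z] a square root of the product of the off-diagonal entries, and
    the determinant is the product of the two differences with [lam]. [L] is indexed by row minus
    column, the circulants by column minus row; this is the sign in the angles, harmless because
    roots of unity are closed under conjugation. Operators are bare functions on sequences.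
    Linearity, commutation and multiplicativity of symbols are derived, on bounded sequences only,
    from approximation by band operators. *)

Fixpoint csum (n : nat) (f : nat -> C) : C :=
  match n with
  | O => RtoC 0
  | S m => (csum m f + f m)%C
  end.

Lemma csum_ext (n : nat) (f g : nat -> C) :
  (forall k, (k < n)%nat -> f k = g k) -> csum n f = csum n g.
Proof.
  induction n as [|n IH]; intros Hfg; simpl; [reflexivity|].
  rewrite IH, Hfg by (intros; try apply Hfg; lia). reflexivity.
Qed.

Lemma csum_plus (n : nat) (f g : nat -> C) :
  csum n (fun k => f k + g k)%C = (csum n f + csum n g)%C.
Proof. induction n as [|n IH]; simpl; [ring|]. rewrite IH. ring. Qed.

Lemma csum_minus (n : nat) (f g : nat -> C) :
  csum n (fun k => f k - g k)%C = (csum n f - csum n g)%C.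
Proof. induction n as [|n IH]; simpl; [ring|]. rewrite IH. ring. Qed.

Lemma csum_scal (n : nat) (c : C) (f : nat -> C) :
  csum n (fun k => c * f k)%C = (c * csum n f)%C.
Proof. induction n as [|n IH]; simpl; [ring|]. rewrite IH. ring. Qed.

Lemma csum_zero (n : nat) : csum n (fun _ => RtoC 0) = RtoC 0.
Proof. induction n as [|n IH]; simpl; [reflexivity|]. rewrite IH. ring. Qed.

Lemma csum_const (n : nat) (c : C) : csum n (fun _ => c) = (RtoC (INR n) * c)%C.
Proof.
  induction n as [|n IH]; [simpl; ring|].
  cbn [csum]. rewrite IH, S_INR, RtoC_plus. ring.
Qed.

Lemma csum_swap (n m : nat) (f : nat -> nat -> C) :
  csum n (fun i => csum m (fun j => f i j)) = csum m (fun j => csum n (fun i => f i j)).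
Proof.
  induction n as [|n IH]; simpl; [now rewrite csum_zero|].
  rewrite IH, <- csum_plus. reflexivity.
Qed.

Lemma csum_add (n m : nat) (f : nat -> C) :
  csum (n + m) f = (csum n f + csum m (fun k => f (n + k)%nat))%C.
Proof.
  induction m as [|m IH]; simpl.
  - rewrite Nat.add_0_r. ring.
  - rewrite Nat.add_succ_r. simpl. rewrite IH. ring.
Qed.

Lemma csum_first (n : nat) (f : nat -> C) :
  csum (S n) f = (f O + csum n (fun k => f (S k)))%C.
Proof. change (S n) with (1 + n)%nat. rewrite csum_add. cbn [csum]. simpl. ring. Qed.

Lemma csum_rev (n : nat) (f : nat -> C) :
  csum n f = csum n (fun k => f (n - 1 - k)%nat).
Proof.
  induction n as [|n IH]; [reflexivity|].
  rewrite (csum_first n (fun k => f (S n - 1 - k)%nat)). cbn [csum].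
  rewrite IH. replace (S n - 1 - 0)%nat with n by lia.
  rewrite (csum_ext n (fun k => f (S n - 1 - S k)%nat) (fun k => f (n - 1 - k)%nat))
    by (intros; f_equal; lia).
  ring.
Qed.

Lemma csum_single (n m : nat) (f : nat -> C) :
  (m < n)%nat -> (forall k, (k < n)%nat -> k <> m -> f k = RtoC 0) -> csum n f = f m.
Proof.
  intros Hm Hf.
  replace n with (m + S (n - m - 1))%nat by lia.
  rewrite csum_add, csum_first, Nat.add_0_r.
  rewrite (csum_ext m f (fun _ => RtoC 0)) by (intros; apply Hf; lia).
  rewrite (csum_ext (n - m - 1) (fun k => f (m + S k)%nat) (fun _ => RtoC 0))
    by (intros; apply Hf; lia).
  rewrite !csum_zero. ring.
Qed.

Lemma csum_mult (K N : nat) (f : nat -> C) :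
  csum (K * N) f = csum K (fun k => csum N (fun n => f (k * N + n)%nat)).
Proof.
  induction K as [|K IH]; [reflexivity|].
  replace (S K * N)%nat with (K * N + N)%nat by lia.
  rewrite csum_add. cbn [csum]. now rewrite IH.
Qed.

Lemma Cmod_csum_le (n : nat) (f : nat -> C) (M : R) :
  (forall k, (k < n)%nat -> Cmod (f k) <= M) -> Cmod (csum n f) <= INR n * M.
Proof.
  induction n as [|n IH]; intros Hf.
  - simpl. rewrite Cmod_0. lra.
  - cbn [csum]. rewrite S_INR.
    generalize (Cmod_triangle (csum n f) (f n)).
    assert (Cmod (csum n f) <= INR n * M) by (apply IH; intros; apply Hf; lia).
    generalize (Hf n (Nat.lt_succ_diag_r n)). lra.
Qed.

Lemma Cmod_minus_le (x y : C) : Cmod (x - y)%C <= Cmod x + Cmod y.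
Proof.
  unfold Cminus. generalize (Cmod_triangle x (- y)%C). rewrite Cmod_opp. lra.
Qed.

Lemma Cmod_minus_sym (x y : C) : Cmod (x - y)%C = Cmod (y - x)%C.
Proof. rewrite <- Cmod_opp. f_equal. ring. Qed.

Lemma Cmod_dist_triangle (x y z : C) : Cmod (x - z)%C <= Cmod (x - y)%C + Cmod (y - z)%C.
Proof.
  replace (x - z)%C with ((x - y) + (y - z))%C by ring. apply Cmod_triangle.
Qed.

Lemma Cmod_le_abs (x : C) : Cmod x <= Rabs (fst x) + Rabs (snd x).
Proof.
  destruct x as [u v]. unfold Cmod. simpl fst; simpl snd.
  rewrite <- (sqrt_pow2 (Rabs u + Rabs v)).
  - apply sqrt_le_1_alt. rewrite <- (pow2_abs u), <- (pow2_abs v).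
    generalize (Rabs_pos u) (Rabs_pos v). nra.
  - generalize (Rabs_pos u) (Rabs_pos v). lra.
Qed.

Lemma Ceq_of_Cmod_small (x y : C) :
  (forall eps, 0 < eps -> Cmod (x - y)%C <= eps) -> x = y.
Proof.
  intros Hxy. assert (H0 : Cmod (x - y)%C = 0).
  { apply Rle_antisym; [|apply Cmod_ge_0]. apply le_epsilon. intros eps Heps.
    rewrite Rplus_0_l. now apply Hxy. }
  apply Cmod_eq_0 in H0. replace x with ((x - y) + y)%C by ring. rewrite H0. ring.
Qed.

(** * Characters and the discrete Fourier transform *)

Definition cis (t : R) : C := (cos t, sin t).

Lemma cis_plus (s t : R) : cis (s + t) = (cis s * cis t)%C.
Proof.
  unfold cis, Cmult; simpl. rewrite cos_plus, sin_plus. f_equal; ring.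
Qed.

Lemma cis_0 : cis 0 = RtoC 1.
Proof. unfold cis. now rewrite cos_0, sin_0. Qed.

Lemma cis_2PI : cis (2 * PI) = RtoC 1.
Proof. unfold cis. now rewrite cos_2PI, sin_2PI. Qed.

Lemma Cmod_cis (t : R) : Cmod (cis t) = 1.
Proof.
  unfold Cmod, cis; simpl fst; simpl snd.
  replace (cos t ^ 2 + sin t ^ 2) with 1; [apply sqrt_1|].
  generalize (sin2_cos2 t). unfold Rsqr. lra.
Qed.

Lemma cis_opp (t : R) : cis (- t) = Cconj (cis t).
Proof. unfold cis, Cconj; simpl. now rewrite cos_neg, sin_neg. Qed.

Lemma cis_mul_opp (t : R) : (cis t * cis (- t))%C = RtoC 1.
Proof. rewrite <- cis_plus, Rplus_opp_r. apply cis_0. Qed.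

Lemma cis_mult_nat (t : R) (n : nat) : cis t = RtoC 1 -> cis (INR n * t) = RtoC 1.
Proof.
  intros Ht. induction n as [|n IH].
  - simpl. rewrite Rmult_0_l. apply cis_0.
  - rewrite S_INR, Rmult_plus_distr_r, Rmult_1_l, cis_plus, IH, Ht. ring.
Qed.

(** Here [cos t = 1 - 2 sin^2 (t / 2)], and [t / 2] lies strictly between [0] and [PI]. *)
Lemma cis_neq_1 (t : R) : 0 < t < 2 * PI -> cis t <> RtoC 1.
Proof.
  intros [H1 H2] E. injection E as Ec _.
  replace t with (2 * (t / 2)) in Ec by field.
  rewrite cos_2a_sin in Ec.
  assert (0 < sin (t / 2)) by (apply sin_gt_0; lra). nra.
Qed.

Lemma csum_cis_zero (N : nat) (t : R) :
  cis (INR N * t) = RtoC 1 -> cis t <> RtoC 1 ->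
  csum N (fun j => cis (INR j * t)) = RtoC 0.
Proof.
  intros HN Ht.
  (* Geometric sum in multiplied-out form, so that the division by [cis t - 1] happens only once. *)
  assert (G : ((cis t - 1) * csum N (fun j => cis (INR j * t)) = cis (INR N * t) - 1)%C).
  { clear HN. induction N as [|N IH].
    - simpl. rewrite Rmult_0_l, cis_0. ring.
    - cbn [csum]. rewrite S_INR, Rmult_plus_distr_r, Rmult_1_l, cis_plus.
      rewrite Cmult_plus_distr_l, IH. ring. }
  rewrite HN in G.
  assert (Hne : (cis t - 1)%C <> RtoC 0).
  { intros E. apply Ht. replace (cis t) with ((cis t - 1) + 1)%C by ring. rewrite E. ring. }
  apply (f_equal (fun z => (/ (cis t - 1) * z)%C)) in G.
  rewrite Cmult_assoc, Cinv_l, Cmult_1_l in G by exact Hne. rewrite G. ring.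
Qed.

Definition root_angle (N j : nat) : R := INR j * (2 * PI / INR N).

Lemma cis_root_angle (N j : nat) : (0 < N)%nat -> cis (INR N * root_angle N j) = RtoC 1.
Proof.
  intros HN. unfold root_angle.
  replace (INR N * (INR j * (2 * PI / INR N))) with (INR j * (2 * PI)).
  - apply cis_mult_nat, cis_2PI.
  - field. apply not_0_INR. lia.
Qed.

Lemma cis_root_neq_1 (N k : nat) : (0 < k < N)%nat -> cis (root_angle N k) <> RtoC 1.
Proof.
  intros Hk. apply cis_neq_1. unfold root_angle.
  assert (0 < INR k < INR N) by (split; [apply lt_0_INR|apply lt_INR]; lia).
  generalize PI_RGT_0; intros HPI.
  replace (INR k * (2 * PI / INR N)) with (2 * PI * (INR k / INR N)) by (field; lra).
  assert (0 < INR k / INR N) by (apply Rdiv_lt_0_compat; lra).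
  assert (INR k / INR N < 1) by (apply Rlt_div_l; lra).
  split; nra.
Qed.

(** Orthogonality of characters: after exchanging the sums, [c k] is multiplied by a geometric sum
    of powers of the root of unity with index [m - k], which vanishes unless [k = m]. *)
Lemma dft_inversion (N m : nat) (c : nat -> C) :
  (m < N)%nat ->
  csum N (fun j => cis (INR m * root_angle N j)
                   * csum N (fun k => cis (- (INR k * root_angle N j)) * c k))%C
  = (RtoC (INR N) * c m)%C.
Proof.
  intros Hm.
  rewrite (csum_ext N _ (fun j => csum N (fun k =>
    c k * (cis (INR m * root_angle N j) * cis (- (INR k * root_angle N j))))%C)).
  2:{ intros j _. rewrite <- csum_scal. apply csum_ext. intros; ring. }
  rewrite csum_swap, (csum_single N m); [|exact Hm|].
  - rewrite (csum_ext N _ (fun _ => c m)).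
    + apply csum_const.
    + intros j _. rewrite cis_mul_opp. ring.
  - intros k Hk Hkm. rewrite csum_scal.
    enough (E : csum N (fun j => (cis (INR m * root_angle N j)
                                  * cis (- (INR k * root_angle N j)))%C) = RtoC 0)
      by (rewrite E; ring).
    assert (HN : INR N <> 0) by (apply not_0_INR; lia).
    (* Subtraction on [nat] truncates, so the two signs of [m - k] are separate cases; the negative
       one is reduced to [k - m] by conjugation. *)
    destruct (Nat.lt_total k m) as [Hlt|[->|Hlt]]; [|congruence|].
    + rewrite (csum_ext N _ (fun j => cis (INR j * root_angle N (m - k)))).
      * apply csum_cis_zero; [apply cis_root_angle; lia|apply cis_root_neq_1; lia].
      * intros j _. rewrite <- cis_plus. f_equal. unfold root_angle.
        rewrite minus_INR by lia. field. exact HN.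
    + rewrite (csum_ext N _ (fun j => cis (INR j * - root_angle N (k - m)))).
      * apply csum_cis_zero.
        -- replace (INR N * - root_angle N (k - m)) with (- (INR N * root_angle N (k - m)))
             by ring.
           rewrite cis_opp, cis_root_angle by lia. unfold Cconj, RtoC; simpl. f_equal; ring.
        -- rewrite cis_opp. intros E. apply (cis_root_neq_1 N (k - m)); [lia|].
           rewrite <- (Cconj_conj (cis _)), E. unfold Cconj, RtoC; simpl. f_equal; ring.
      * intros j _. rewrite <- cis_plus. f_equal. unfold root_angle.
        rewrite minus_INR by lia. field. exact HN.
Qed.

(** * Series of complex numbers *)

(** Componentwise, so that a [CZsum] is convertible to a sum of two such series. *)
Definition cseries (a : nat -> C) : C :=
  (Series (fun n => fst (a n)), Series (fun n => snd (a n))).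

Lemma Rabs_fst_le (z : C) : Rabs (fst z) <= Cmod z.
Proof. apply Rle_trans with (2 := Rmax_Cmod z). apply Rmax_l. Qed.

Lemma Rabs_snd_le (z : C) : Rabs (snd z) <= Cmod z.
Proof. apply Rle_trans with (2 := Rmax_Cmod z). apply Rmax_r. Qed.

Lemma ex_series_dominated (a b : nat -> R) :
  (forall n, Rabs (a n) <= b n) -> ex_series b -> ex_series a.
Proof. exact (ex_series_le (K := R_AbsRing) (V := R_CompleteNormedModule) a b). Qed.

Lemma ex_series_fst (a : nat -> C) (b : nat -> R) :
  (forall n, Cmod (a n) <= b n) -> ex_series b -> ex_series (fun n => fst (a n)).
Proof.
  intros Hab. apply ex_series_dominated. intros n.
  apply Rle_trans with (2 := Hab n). apply Rabs_fst_le.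
Qed.

Lemma ex_series_snd (a : nat -> C) (b : nat -> R) :
  (forall n, Cmod (a n) <= b n) -> ex_series b -> ex_series (fun n => snd (a n)).
Proof.
  intros Hab. apply ex_series_dominated. intros n.
  apply Rle_trans with (2 := Hab n). apply Rabs_snd_le.
Qed.

Lemma Rabs_Series_le (a b : nat -> R) :
  (forall n, Rabs (a n) <= b n) -> ex_series b -> Rabs (Series a) <= Series b.
Proof.
  intros Hab Hb. eapply Rle_trans.
  - apply Series_Rabs. apply ex_series_dominated with b; [|exact Hb].
    intros n. rewrite Rabs_Rabsolu. apply Hab.
  - apply Series_le; [|exact Hb]. intros n. split; [apply Rabs_pos|apply Hab].
Qed.

Lemma ex_series_tail (a : nat -> R) (n : nat) :
  ex_series a -> ex_series (fun k => a (n + k)%nat).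
Proof.
  intros Ha. apply (ex_series_incr_n (K := R_AbsRing) (V := R_NormedModule) a n). exact Ha.
Qed.

(** The factor [2] comes from estimating real and imaginary parts separately. *)
Lemma cseries_tail (a : nat -> C) (b : nat -> R) (n : nat) :
  (forall n, Cmod (a n) <= b n) -> ex_series b ->
  Cmod (cseries a - csum n a)%C <= 2 * Series (fun k => b (n + k)%nat).
Proof.
  intros Hab Hb.
  assert (E : (cseries a - csum n a)%C = cseries (fun k => a (n + k)%nat)).
  { induction n as [|n IH].
    - simpl. unfold Cminus. rewrite Copp_0, Cplus_0_r. reflexivity.
    - cbn [csum].
      replace (cseries a - (csum n a + a n))%C with ((cseries a - csum n a) - a n)%C by ring.
      rewrite IH. unfold cseries.
      rewrite (Series_incr_1 (fun k => fst (a (n + k)%nat))).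
      2:{ apply (ex_series_fst (fun k => a (n + k)%nat) (fun k => b (n + k)%nat));
          [intros; apply Hab|now apply ex_series_tail]. }
      rewrite (Series_incr_1 (fun k => snd (a (n + k)%nat))).
      2:{ apply (ex_series_snd (fun k => a (n + k)%nat) (fun k => b (n + k)%nat));
          [intros; apply Hab|now apply ex_series_tail]. }
      rewrite Nat.add_0_r. unfold Cminus, Cplus, Copp; simpl.
      f_equal; (rewrite Rplus_comm, <- Rplus_assoc, Rplus_opp_l, Rplus_0_l;
        apply Series_ext; intros k; now rewrite Nat.add_succ_r). }
  rewrite E. clear E. eapply Rle_trans; [apply Cmod_le_abs|]. unfold cseries; simpl.
  assert (Hb' := ex_series_tail b n Hb).
  assert (Rabs (Series (fun k => fst (a (n + k)%nat))) <= Series (fun k => b (n + k)%nat)).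
  { apply Rabs_Series_le; [|exact Hb']. intros k.
    apply Rle_trans with (2 := Hab _). apply Rabs_fst_le. }
  assert (Rabs (Series (fun k => snd (a (n + k)%nat))) <= Series (fun k => b (n + k)%nat)).
  { apply Rabs_Series_le; [|exact Hb']. intros k.
    apply Rle_trans with (2 := Hab _). apply Rabs_snd_le. }
  lra.
Qed.

(** * Band operators on two-sided sequences *)

Definition op := (Z -> C) -> Z -> C.

Definition bnd (x : Z -> C) (M : R) : Prop := forall i, Cmod (x i) <= M.

Definition ech (t : R) (k : Z) : C := cis (IZR k * t).

(** Laurent polynomials in the shift, with exponents between [-d] and [d]. Generating them
    inductively turns linearity, commutation and boundedness into short inductions; the coefficients
    are recovered in [band_coef] when they are needed. *)
Inductive band (d : nat) : op -> Prop :=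
| band_zero : band d (fun _ _ => RtoC 0)
| band_shift (c : C) (k : Z) : (Z.abs k <= Z.of_nat d)%Z ->
    band d (fun x i => (c * x (i - k)%Z)%C)
| band_plus (T U : op) : band d T -> band d U -> band d (fun x i => (T x i + U x i)%C).

Lemma band_ext (d : nat) (T U : op) :
  (forall x i, T x i = U x i) -> band d T -> band d U.
Proof.
  intros E HT. replace U with T; [exact HT|].
  apply functional_extensionality; intros x. apply functional_extensionality; intros i.
  apply E.
Qed.

Lemma band_mono (d d' : nat) (T : op) : (d <= d')%nat -> band d T -> band d' T.
Proof.
  intros Hd. induction 1 as [|c k Hk|T U _ IT _ IU].
  - apply band_zero.
  - apply band_shift. lia.
  - now apply band_plus.
Qed.

Lemma band_id (d : nat) : band d (fun x => x).
Proof.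
  apply (band_ext d (fun x i => (1 * x (i - 0)%Z)%C)).
  - intros x i. rewrite Z.sub_0_r. ring.
  - apply band_shift. lia.
Qed.

Lemma band_shift_comp (d d' : nat) (U : op) (c : C) (k : Z) :
  (Z.abs k <= Z.of_nat d)%Z -> band d' U -> band (d + d') (fun x i => (c * U x (i - k)%Z)%C).
Proof.
  intros Hk. induction 1 as [|c' k' Hk'|T U _ IT _ IU].
  - apply (band_ext _ (fun _ _ => RtoC 0)); [intros; ring|apply band_zero].
  - apply (band_ext _ (fun x i => ((c * c') * x (i - (k + k'))%Z)%C)).
    + intros x i. rewrite Z.sub_add_distr. ring.
    + apply band_shift. lia.
  - eapply band_ext; [|apply band_plus; [exact IT|exact IU]]. intros x i. simpl. ring.
Qed.

Lemma band_comp (d d' : nat) (T U : op) :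
  band d T -> band d' U -> band (d + d') (fun x => T (U x)).
Proof.
  intros HT HU. induction HT as [|c k Hk|T1 T2 _ I1 _ I2].
  - apply band_zero.
  - now apply band_shift_comp.
  - exact (band_plus _ _ _ I1 I2).
Qed.

Lemma band_scal (d : nat) (c : C) (T : op) : band d T -> band d (fun x i => (c * T x i)%C).
Proof.
  intros HT. apply (band_ext _ (fun x i => (c * T x (i - 0)%Z)%C)).
  - intros. now rewrite Z.sub_0_r.
  - apply (band_shift_comp 0); [lia|exact HT].
Qed.

Lemma band_add_arg (d : nat) (T : op) (x y : Z -> C) (i : Z) :
  band d T -> T (fun j => (x j + y j)%C) i = (T x i + T y i)%C.
Proof.
  induction 1 as [|c k Hk|T U _ IT _ IU]; [ring|ring|]. rewrite IT, IU. ring.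
Qed.

Lemma band_scal_arg (d : nat) (T : op) (c : C) (x : Z -> C) (i : Z) :
  band d T -> T (fun j => (c * x j)%C) i = (c * T x i)%C.
Proof.
  induction 1 as [|c' k Hk|T U _ IT _ IU]; [ring|ring|]. rewrite IT, IU. ring.
Qed.

Lemma band_sub_arg (d : nat) (T : op) (x y : Z -> C) (i : Z) :
  band d T -> T (fun j => (x j - y j)%C) i = (T x i - T y i)%C.
Proof.
  induction 1 as [|c k Hk|T U _ IT _ IU]; [ring|ring|]. rewrite IT, IU. ring.
Qed.

Lemma band_shift_arg (d : nat) (T : op) (c : C) (k : Z) (x : Z -> C) (i : Z) :
  band d T -> T (fun j => (c * x (j - k)%Z)%C) i = (c * T x (i - k)%Z)%C.
Proof.
  induction 1 as [|c' k' Hk|T U _ IT _ IU]; [ring| |].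
  - replace (i - k - k')%Z with (i - k' - k)%Z by ring. ring.
  - rewrite IT, IU. ring.
Qed.

(** One operator is a combination of shifts, and the other is linear and commutes with shifts. *)
Lemma band_comm (d d' : nat) (T U : op) (x : Z -> C) (i : Z) :
  band d T -> band d' U -> T (U x) i = U (T x) i.
Proof.
  intros HT HU. induction HT as [|c k Hk|T1 T2 _ I1 _ I2].
  - replace (fun _ : Z => RtoC 0) with (fun j : Z => (0 * x j)%C).
    + rewrite (band_scal_arg d') by exact HU. ring.
    + apply functional_extensionality; intros; ring.
  - symmetry. now apply (band_shift_arg d').
  - rewrite I1, I2. symmetry. now apply (band_add_arg d').
Qed.

Lemma bnd_nonneg (x : Z -> C) (M : R) : bnd x M -> 0 <= M.
Proof. intros Hx. apply Rle_trans with (2 := Hx 0%Z). apply Cmod_ge_0. Qed.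

Lemma band_bounded (d : nat) (T : op) :
  band d T -> exists K, 0 <= K /\ forall x M, bnd x M -> bnd (T x) (K * M).
Proof.
  induction 1 as [|c k Hk|T U _ IT _ IU].
  - exists 0. split; [lra|]. intros x M _ i. rewrite Cmod_0. lra.
  - exists (Cmod c). split; [apply Cmod_ge_0|]. intros x M Hx i. rewrite Cmod_mult.
    apply Rmult_le_compat_l; [apply Cmod_ge_0|apply Hx].
  - destruct IT as (K1 & HK1 & H1), IU as (K2 & HK2 & H2).
    exists (K1 + K2). split; [lra|]. intros x M Hx i.
    eapply Rle_trans; [apply Cmod_triangle|].
    generalize (H1 x M Hx i) (H2 x M Hx i). lra.
Qed.

(** Natural indices are offset by [d]: [c k] is the coefficient of the shift by [k - d]. *)
Lemma band_coef (d : nat) (T : op) :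
  band d T -> exists c : nat -> C, forall x i,
    T x i = csum (2 * d + 1) (fun k => c k * x (i + Z.of_nat d - Z.of_nat k)%Z)%C.
Proof.
  induction 1 as [|c k Hk|T U _ [c1 H1] _ [c2 H2]].
  - exists (fun _ => RtoC 0). intros x i.
    rewrite (csum_ext _ _ (fun _ => RtoC 0)) by (intros; ring). now rewrite csum_zero.
  - exists (fun j => if Nat.eq_dec j (Z.to_nat (k + Z.of_nat d)) then c else RtoC 0).
    intros x i. rewrite (csum_single _ (Z.to_nat (k + Z.of_nat d))).
    + destruct (Nat.eq_dec _ _) as [_|]; [|congruence]. f_equal. f_equal.
      rewrite Z2Nat.id by lia. ring.
    + lia.
    + intros j _ Hj. destruct (Nat.eq_dec _ _); [contradiction|ring].
  - exists (fun j => (c1 j + c2 j)%C). intros x i. rewrite H1, H2, <- csum_plus.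
    apply csum_ext. intros; ring.
Qed.

(** The Hilbert space adjoint of a convolution: it sends [c] times the shift by [k] to the conjugate
    of [c] times the shift by [-k], so the symbol is conjugated. Conjugation and reflection express
    it for an arbitrary [op], without access to coefficients. *)
Definition adj (T : op) : op :=
  fun x i => Cconj (T (fun k => Cconj (x (- k)%Z)) (- i)%Z).

Lemma band_adj (d : nat) (T : op) : band d T -> band d (adj T).
Proof.
  unfold adj. induction 1 as [|c k Hk|T U _ IT _ IU].
  - apply (band_ext _ (fun _ _ => RtoC 0)); [|apply band_zero].
    intros. unfold Cconj, RtoC; simpl. f_equal; ring.
  - apply (band_ext _ (fun x i => (Cconj c * x (i - - k)%Z)%C)).
    + intros x i. rewrite Cmult_conj, Cconj_conj. f_equal. f_equal. ring.
    + apply band_shift. lia.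
  - eapply band_ext; [|apply band_plus; [exact IT|exact IU]].
    intros x i. simpl. now rewrite Cplus_conj.
Qed.

Lemma ech_bnd (t : R) : bnd (ech t) 1.
Proof. intros i. unfold ech. rewrite Cmod_cis. lra. Qed.

Lemma ech_sub (t : R) (i k : Z) : ech t (i - k) = (ech t i * ech t (- k)%Z)%C.
Proof. unfold ech. rewrite <- cis_plus. f_equal. rewrite minus_IZR, opp_IZR. ring. Qed.

Lemma ech_0 (t : R) : ech t 0 = RtoC 1.
Proof. unfold ech. rewrite Rmult_0_l. apply cis_0. Qed.

(** Since [ech t 0 = 1], evaluation at [0] reads off the eigenvalue; [T (ech t) 0] is the symbol of
    [T] at [t] in all that follows. *)
Lemma band_ech (d : nat) (T : op) (t : R) (i : Z) :
  band d T -> T (ech t) i = (T (ech t) 0%Z * ech t i)%C.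
Proof.
  induction 1 as [|c k Hk|T U _ IT _ IU]; [ring| |].
  - rewrite (ech_sub t i k), (ech_sub t 0 k), ech_0. ring.
  - rewrite IT, IU. ring.
Qed.

Lemma Rabs_sin_le (x : R) : Rabs (sin x) <= Rabs x.
Proof.
  assert (G : forall y, 0 <= y -> Rabs (sin y) <= y).
  { intros y [Hy|<-]; [|rewrite sin_0, Rabs_R0; lra].
    apply Rabs_le. split; [|apply Rlt_le, sin_lt_x, Hy].
    destruct (Rle_dec y PI) as [Hp|Hp].
    - apply Rle_trans with 0; [lra|]. apply sin_ge_0; lra.
    - generalize (SIN_bound y) PI2_1. lra. }
  destruct (Rle_dec 0 x) as [Hx|Hx].
  - rewrite (Rabs_pos_eq x) by exact Hx. now apply G.
  - rewrite <- (Ropp_involutive x) at 1. rewrite sin_neg, Rabs_Ropp, (Rabs_left x) by lra.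
    apply G. lra.
Qed.

Lemma cis_lipschitz (s t : R) : Cmod (cis s - cis t)%C <= 2 * Rabs (s - t).
Proof.
  eapply Rle_trans; [apply Cmod_le_abs|]. unfold cis; simpl.
  (* Sum-to-product formulas: each component changes by at most [Rabs (s - t)]. *)
  rewrite <- !Rminus_def, form2, form4.
  assert (Hs := Rabs_sin_le ((s - t) / 2)).
  unfold Rdiv in Hs. rewrite Rabs_mult, (Rabs_pos_eq (/ 2)) in Hs by lra.
  assert (Hb : forall u, Rabs (sin u) <= 1) by (intros; apply Rabs_le, SIN_bound).
  assert (Hc : forall u, Rabs (cos u) <= 1) by (intros; apply Rabs_le, COS_bound).
  rewrite !Rabs_mult, (Rabs_left (-2)), (Rabs_pos_eq 2) by lra.
  assert (G : forall u, Rabs u <= 1 -> 2 * Rabs (sin ((s - t) / 2)) * Rabs u <= Rabs (s - t)).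
  { intros u Hu. unfold Rdiv. generalize (Rabs_pos (sin ((s - t) * / 2))) (Rabs_pos u). nra. }
  generalize (G _ (Hb ((s + t) / 2))).
  assert (G' := G _ (Hc ((s + t) / 2))).
  rewrite (Rmult_assoc 2 (Rabs (cos _))), (Rmult_comm (Rabs (cos _))), <- Rmult_assoc.
  lra.
Qed.

Lemma band_lipschitz (d : nat) (T : op) :
  band d T -> exists K, 0 <= K /\ forall s t,
    Cmod (T (ech s) 0%Z - T (ech t) 0%Z)%C <= K * Rabs (s - t).
Proof.
  induction 1 as [|c k Hk|T U _ IT _ IU].
  - exists 0. split; [lra|]. intros s t.
    replace (0 - 0)%C with (RtoC 0) by ring. rewrite Cmod_0. lra.
  - exists (Cmod c * (2 * Rabs (IZR (0 - k)))). split.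
    + generalize (Cmod_ge_0 c) (Rabs_pos (IZR (0 - k))). nra.
    + intros s t. unfold ech.
      replace (c * cis (IZR (0 - k) * s) - c * cis (IZR (0 - k) * t))%C
        with (c * (cis (IZR (0 - k) * s) - cis (IZR (0 - k) * t)))%C by ring.
      rewrite Cmod_mult, Rmult_assoc. apply Rmult_le_compat_l; [apply Cmod_ge_0|].
      eapply Rle_trans; [apply cis_lipschitz|].
      rewrite <- Rmult_minus_distr_l, Rabs_mult. lra.
  - destruct IT as (K1 & HK1 & H1), IU as (K2 & HK2 & H2).
    exists (K1 + K2). split; [lra|]. intros s t.
    replace (T (ech s) 0%Z + U (ech s) 0%Z - (T (ech t) 0%Z + U (ech t) 0%Z))%C with
      ((T (ech s) 0%Z - T (ech t) 0%Z) + (U (ech s) 0%Z - U (ech t) 0%Z))%C by ring.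
    eapply Rle_trans; [apply Cmod_triangle|].
    generalize (H1 s t) (H2 s t). lra.
Qed.

(* The coefficients are the inverse discrete Fourier transform of the symbol. *)
Lemma band_norm (d : nat) (T : op) (rho : R) (x : Z -> C) (M : R) :
  band d T ->
  (forall j, (j < 2 * d + 1)%nat -> Cmod (T (ech (root_angle (2 * d + 1) j)) 0%Z) <= rho) ->
  bnd x M -> bnd (T x) (INR (2 * d + 1) * (rho * M)).
Proof.
  intros HT Hrho Hx i. destruct (band_coef d T HT) as [c Hc].
  (* As many sample points as there are possible coefficients, so no aliasing occurs. *)
  remember (2 * d + 1)%nat as N eqn:EN.
  assert (HN : 0 < INR N) by (apply lt_0_INR; lia).
  assert (Hcm : forall m, (m < N)%nat -> Cmod (c m) <= rho).
  { intros m Hm. assert (D := dft_inversion N m c Hm).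
    apply (f_equal Cmod) in D. rewrite Cmod_mult, Cmod_R, Rabs_pos_eq in D by lra.
    apply Rmult_le_reg_l with (INR N); [exact HN|]. rewrite <- D.
    apply Cmod_csum_le. intros j Hj. rewrite Cmod_mult, Cmod_cis, Rmult_1_l.
    (* The phase [cis (- d t)] undoes the index offset of [band_coef]. *)
    replace (csum N _) with (cis (- (INR d * root_angle N j)) * T (ech (root_angle N j)) 0%Z)%C.
    - rewrite Cmod_mult, Cmod_cis, Rmult_1_l. now apply Hrho.
    - rewrite Hc, <- csum_scal. apply csum_ext. intros k _. unfold ech.
      rewrite (Cmult_comm (c k)), Cmult_assoc, <- cis_plus. f_equal. f_equal.
      rewrite !minus_IZR, plus_IZR, <- !INR_IZR_INZ. ring. }
  rewrite Hc. apply Cmod_csum_le. intros k Hk. rewrite Cmod_mult.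
  apply Rmult_le_compat; try apply Cmod_ge_0; [now apply Hcm|apply Hx].
Qed.

(** * Uniform limits of band operators *)

(* On unbounded sequences such an operator may take arbitrary values. *)
Definition appr (T : op) : Prop :=
  forall eps, 0 < eps -> exists d P, band d P /\
    forall x M, bnd x M -> bnd (fun i => (T x i - P x i)%C) (eps * M).

Lemma small_factor (A eps : R) : 0 <= A -> 0 < eps -> exists e, 0 < e /\ e * A <= eps.
Proof.
  (* Dividing by [A + 1] rather than [A] covers [A = 0]. *)
  intros HA He. exists (eps / (A + 1)).
  assert (0 < eps / (A + 1)) by (apply Rdiv_lt_0_compat; lra).
  split; [assumption|].
  assert (eps / (A + 1) * (A + 1) = eps) by (field; lra). nra.
Qed.

Lemma appr_band (d : nat) (T : op) : band d T -> appr T.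
Proof.
  intros HT eps He. exists d, T. split; [exact HT|]. intros x M Hx i.
  replace (T x i - T x i)%C with (RtoC 0) by ring. rewrite Cmod_0.
  generalize (bnd_nonneg x M Hx). nra.
Qed.

Lemma appr_id : appr (fun x => x).
Proof. exact (appr_band 0 _ (band_id 0)). Qed.

Lemma appr_plus (T U : op) : appr T -> appr U -> appr (fun x i => (T x i + U x i)%C).
Proof.
  intros HT HU eps He.
  destruct (HT (eps / 2)) as (d1 & P1 & B1 & E1); [lra|].
  destruct (HU (eps / 2)) as (d2 & P2 & B2 & E2); [lra|].
  exists (d1 + d2)%nat, (fun x i => (P1 x i + P2 x i)%C). split.
  - apply band_plus; eapply band_mono; try eassumption; lia.
  - intros x M Hx i.
    replace (T x i + U x i - (P1 x i + P2 x i))%C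
      with ((T x i - P1 x i) + (U x i - P2 x i))%C by ring.
    eapply Rle_trans; [apply Cmod_triangle|].
    generalize (E1 x M Hx i) (E2 x M Hx i). simpl. lra.
Qed.

Lemma appr_scal (c : C) (T : op) : appr T -> appr (fun x i => (c * T x i)%C).
Proof.
  intros HT eps He. assert (Hc0 := Cmod_ge_0 c).
  destruct (small_factor (Cmod c) eps Hc0 He) as (e & He' & Hc).
  destruct (HT e He') as (d & P & B & E).
  exists d, (fun x i => (c * P x i)%C). split; [now apply band_scal|].
  intros x M Hx i. replace (c * T x i - c * P x i)%C with (c * (T x i - P x i))%C by ring.
  rewrite Cmod_mult. generalize (E x M Hx i) (Cmod_ge_0 c) (bnd_nonneg x M Hx). simpl.
  intros. apply Rle_trans with (Cmod c * (e * M)); [now apply Rmult_le_compat_l|nra].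
Qed.

Lemma appr_bounded (T : op) :
  appr T -> exists K, 0 < K /\ forall x M, bnd x M -> bnd (T x) (K * M).
Proof.
  intros HT. destruct (HT 1 Rlt_0_1) as (d & P & B & E).
  destruct (band_bounded d P B) as (K & HK & BK).
  exists (K + 1). split; [lra|]. intros x M Hx i.
  replace (T x i) with (P x i + (T x i - P x i))%C by ring.
  eapply Rle_trans; [apply Cmod_triangle|].
  generalize (E x M Hx i) (BK x M Hx i). simpl. lra.
Qed.

Lemma bnd_add (x y : Z -> C) (M M' : R) :
  bnd x M -> bnd y M' -> bnd (fun j => (x j + y j)%C) (M + M').
Proof.
  intros Hx Hy i. eapply Rle_trans; [apply Cmod_triangle|].
  generalize (Hx i) (Hy i). lra.
Qed.

Lemma bnd_scal (c : C) (x : Z -> C) (M : R) :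
  bnd x M -> bnd (fun j => (c * x j)%C) (Cmod c * M).
Proof.
  intros Hx i. rewrite Cmod_mult. apply Rmult_le_compat_l; [apply Cmod_ge_0|apply Hx].
Qed.

(** Additivity is inherited from the approximating band operators: the defect is smaller than any
    [eps] once all three arguments are bounded. *)
Lemma appr_add_arg (T : op) (x y : Z -> C) (M M' : R) (i : Z) :
  appr T -> bnd x M -> bnd y M' -> T (fun j => (x j + y j)%C) i = (T x i + T y i)%C.
Proof.
  intros HT Hx Hy. apply Ceq_of_Cmod_small. intros eps He.
  assert (HM := bnd_nonneg x M Hx). assert (HM' := bnd_nonneg y M' Hy).
  destruct (small_factor (2 * (M + M')) eps) as (e & He' & Hs); [lra|exact He|].
  destruct (HT e He') as (d & P & B & E).
  generalize (E _ _ Hx i) (E _ _ Hy i) (E _ _ (bnd_add x y M M' Hx Hy) i). simpl.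
  rewrite (band_add_arg d P) by exact B. intros E1 E2 E3.
  replace (T (fun j => (x j + y j)%C) i - (T x i + T y i))%C with
    ((T (fun j => (x j + y j)%C) i - (P x i + P y i)) - ((T x i - P x i) + (T y i - P y i)))%C
    by ring.
  eapply Rle_trans; [apply Cmod_minus_le|].
  generalize (Cmod_triangle (T x i - P x i)%C (T y i - P y i)%C). lra.
Qed.

Lemma appr_scal_arg (T : op) (c : C) (x : Z -> C) (M : R) (i : Z) :
  appr T -> bnd x M -> T (fun j => (c * x j)%C) i = (c * T x i)%C.
Proof.
  intros HT Hx. apply Ceq_of_Cmod_small. intros eps He.
  assert (HM := bnd_nonneg x M Hx). assert (Hc := Cmod_ge_0 c).
  destruct (small_factor (2 * (Cmod c * M)) eps) as (e & He' & Hs); [nra|exact He|].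
  destruct (HT e He') as (d & P & B & E).
  generalize (bnd_scal c _ _ (E _ _ Hx) i) (E _ _ (bnd_scal c x M Hx) i). simpl.
  rewrite (band_scal_arg d P) by exact B. intros E1 E2.
  replace (T (fun j => (c * x j)%C) i - c * T x i)%C with
    ((T (fun j => (c * x j)%C) i - c * P x i) - c * (T x i - P x i))%C by ring.
  eapply Rle_trans; [apply Cmod_minus_le|]. nra.
Qed.

Lemma appr_zero_arg (T : op) (i : Z) : appr T -> T (fun _ => RtoC 0) i = RtoC 0.
Proof.
  intros HT. assert (H1 := appr_scal_arg T (RtoC 0) (ech 0) 1 i HT (ech_bnd 0)).
  replace (fun j => (0 * ech 0 j)%C) with (fun _ : Z => RtoC 0) in H1.
  - rewrite H1. ring.
  - apply functional_extensionality; intros; ring.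
Qed.

Lemma appr_sub_arg (T : op) (x y : Z -> C) (M M' : R) (i : Z) :
  appr T -> bnd x M -> bnd y M' -> T (fun j => (x j - y j)%C) i = (T x i - T y i)%C.
Proof.
  intros HT Hx Hy.
  assert (E := appr_add_arg T x (fun j => (- (1) * y j)%C) M _ i HT Hx (bnd_scal _ _ _ Hy)).
  rewrite (appr_scal_arg T _ y M') in E by assumption.
  replace (fun j => (x j - y j)%C) with (fun j => (x j + - (1) * y j)%C).
  - rewrite E. ring.
  - apply functional_extensionality; intros; ring.
Qed.

Lemma appr_comp (T U : op) : appr T -> appr U -> appr (fun x => T (U x)).
Proof.
  intros HT HU eps He.
  destruct (appr_bounded U HU) as (KU & HKU & BU).
  destruct (small_factor (2 * KU) eps) as (e1 & He1 & Hs1); [lra|exact He|].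
  destruct (HT e1 He1) as (d1 & P & B1 & E1).
  destruct (band_bounded d1 P B1) as (KP & HKP & BP).
  (* The tolerance for [U] depends on the norm of [P], hence is fixed only after [P]. *)
  destruct (small_factor (2 * KP) eps) as (e2 & He2 & Hs2); [lra|exact He|].
  destruct (HU e2 He2) as (d2 & Q & B2 & E2).
  exists (d1 + d2)%nat, (fun x => P (Q x)). split; [now apply band_comp|].
  intros x M Hx i.
  eapply Rle_trans; [apply (Cmod_dist_triangle _ (P (U x) i))|].
  generalize (E1 _ _ (BU _ _ Hx) i). simpl. intros F1.
  assert (F2 := BP _ _ (E2 _ _ Hx) i).
  rewrite (band_sub_arg d1 P) in F2 by exact B1.
  assert (HM := bnd_nonneg x M Hx). nra.
Qed.

Lemma appr_adj (T : op) : appr T -> appr (adj T).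
Proof.
  intros HT eps He. destruct (HT eps He) as (d & P & B & E).
  exists d, (adj P). split; [now apply band_adj|].
  intros x M Hx i. unfold adj. rewrite <- Cminus_conj, Cmod_conj.
  apply (E (fun k => Cconj (x (- k)%Z))). intros k. rewrite Cmod_conj. apply Hx.
Qed.

(** Commutation passes to limits one operator at a time: here [T] is a limit while [Q] is still a
    band operator; [appr_comm] then approximates the second operator. *)
Lemma appr_band_comm (d : nat) (T Q : op) (x : Z -> C) (M : R) (i : Z) :
  appr T -> band d Q -> bnd x M -> T (Q x) i = Q (T x) i.
Proof.
  intros HT BQ Hx. apply Ceq_of_Cmod_small. intros eps He.
  destruct (band_bounded d Q BQ) as (KQ & HKQ & BQ').
  assert (HM := bnd_nonneg x M Hx).
  destruct (small_factor (2 * (KQ * M)) eps) as (e & He' & Hs); [nra|exact He|].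
  destruct (HT e He') as (d' & P & B & E).
  eapply Rle_trans; [apply (Cmod_dist_triangle _ (P (Q x) i))|].
  generalize (E _ _ (BQ' _ _ Hx) i). simpl. intros F1.
  rewrite (band_comm d' d P Q) by assumption. rewrite (band_comm d' d P Q) in F1 by assumption.
  assert (F2 := BQ' _ _ (E _ _ Hx) i).
  rewrite (band_sub_arg d Q) in F2 by exact BQ.
  rewrite (Cmod_minus_sym (Q (P x) i)). nra.
Qed.

Lemma appr_comm (T U : op) (x : Z -> C) (M : R) (i : Z) :
  appr T -> appr U -> bnd x M -> T (U x) i = U (T x) i.
Proof.
  intros HT HU Hx. apply Ceq_of_Cmod_small. intros eps He.
  destruct (appr_bounded T HT) as (KT & HKT & BT).
  destruct (appr_bounded U HU) as (KU & HKU & BU).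
  assert (HM := bnd_nonneg x M Hx).
  destruct (small_factor (2 * (KT * M)) eps) as (e & He' & Hs); [nra|exact He|].
  destruct (HU e He') as (d & Q & B & E).
  destruct (band_bounded d Q B) as (KQ & HKQ & BQ).
  eapply Rle_trans; [apply (Cmod_dist_triangle _ (T (Q x) i))|].
  rewrite <- (appr_sub_arg T (U x) (Q x) (KU * M) (KQ * M)) by auto.
  rewrite (appr_band_comm d T Q x M i) by assumption.
  rewrite (Cmod_minus_sym (Q (T x) i)).
  generalize (BT _ _ (E _ _ Hx) i) (E _ _ (BT _ _ Hx) i). simpl. nra.
Qed.

Lemma appr_ech (T : op) (t : R) (i : Z) :
  appr T -> T (ech t) i = (T (ech t) 0%Z * ech t i)%C.
Proof.
  intros HT. apply Ceq_of_Cmod_small. intros eps He.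
  destruct (HT (eps / 2)) as (d & P & B & E); [lra|].
  generalize (E _ _ (ech_bnd t) i) (E _ _ (ech_bnd t) 0%Z). simpl. intros E1 E2.
  eapply Rle_trans; [apply (Cmod_dist_triangle _ (P (ech t) i))|].
  rewrite (band_ech d P t i) at 2 by exact B.
  replace (P (ech t) 0%Z * ech t i - T (ech t) 0%Z * ech t i)%C
    with (- ((T (ech t) 0%Z - P (ech t) 0%Z) * ech t i))%C by ring.
  assert (H1 : Cmod (ech t i) = 1) by apply Cmod_cis.
  rewrite Cmod_opp, Cmod_mult, H1. lra.
Qed.

Lemma appr_comp_ech (T U : op) (t : R) :
  appr T -> appr U -> T (U (ech t)) 0%Z = (T (ech t) 0%Z * U (ech t) 0%Z)%C.
Proof.
  intros HT HU.
  replace (U (ech t)) with (fun i => (U (ech t) 0%Z * ech t i)%C).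
  - rewrite (appr_scal_arg T _ (ech t) 1) by (try apply ech_bnd; exact HT). rewrite ech_0. ring.
  - apply functional_extensionality; intros i. symmetry. now apply appr_ech.
Qed.

Lemma adj_ech (T : op) (t : R) : adj T (ech t) 0%Z = Cconj (T (ech t) 0%Z).
Proof.
  unfold adj. do 2 f_equal. apply functional_extensionality; intros k.
  unfold ech. rewrite <- cis_opp. f_equal. rewrite opp_IZR. ring.
Qed.

(** The symbol is a uniform limit of Lipschitz functions. Two approximation errors and one Lipschitz
    error, each at most [eps / 4], stay strictly below [eps]. *)
Lemma appr_symbol_continuity (T : op) (t : R) :
  appr T -> continuity_pt (fun s => Cmod (T (ech s) 0%Z)) t.
Proof.
  intros HT eps He. destruct (HT (eps / 4)) as (d & P & B & E); [lra|].
  destruct (band_lipschitz d P B) as (K & HK & L).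
  destruct (small_factor K (eps / 4)) as (e & He' & Hs); [exact HK|lra|].
  exists e. split; [exact He'|]. intros s [_ Hst]. simpl in *. unfold Rdist in *.
  assert (G : Cmod (T (ech s) 0%Z - T (ech t) 0%Z)%C < eps).
  { generalize (E _ _ (ech_bnd s) 0%Z) (E _ _ (ech_bnd t) 0%Z) (L s t). simpl.
    intros E1 E2 E3.
    eapply Rle_lt_trans; [apply (Cmod_dist_triangle _ (P (ech s) 0%Z))|].
    generalize (Cmod_dist_triangle (P (ech s) 0%Z) (P (ech t) 0%Z) (T (ech t) 0%Z)).
    rewrite (Cmod_minus_sym (P (ech t) 0%Z) (T (ech t) 0%Z)).
    generalize (Rabs_pos (s - t)). nra. }
  apply Rle_lt_trans with (2 := G). apply Rabs_le.
  generalize (Cmod_triangle (T (ech s) 0%Z - T (ech t) 0%Z)%C (T (ech t) 0%Z))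
             (Cmod_triangle (T (ech t) 0%Z - T (ech s) 0%Z)%C (T (ech s) 0%Z)).
  rewrite (Cmod_minus_sym (T (ech t) 0%Z) (T (ech s) 0%Z)).
  replace (T (ech s) 0%Z - T (ech t) 0%Z + T (ech t) 0%Z)%C with (T (ech s) 0%Z) by ring.
  replace (T (ech t) 0%Z - T (ech s) 0%Z + T (ech s) 0%Z)%C with (T (ech t) 0%Z) by ring.
  lra.
Qed.

(** * Wiener's lemma *)

(** The slack [+ 1] guarantees at least three sample points when [band_norm] is applied, even for
    [m = 0] or [d = 0]. Symbol bounds are only available at [N]-th roots of unity with [2 <= N],
    because the circulants start at [q = 1]. *)
Lemma iter_band (d m : nat) (P : op) : band d P -> band (m * d + 1) (Nat.iter m P).
Proof.
  intros HP. induction m as [|m IH].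
  - apply band_id.
  - replace (S m * d + 1)%nat with (d + (m * d + 1))%nat by lia.
    exact (band_comp _ _ _ _ HP IH).
Qed.

Lemma iter_band_ech (d m : nat) (P : op) (t : R) :
  band d P -> Cmod (Nat.iter m P (ech t) 0%Z) = Cmod (P (ech t) 0%Z) ^ m.
Proof.
  intros HP. induction m as [|m IH].
  - simpl. rewrite ech_0. apply Cmod_1.
  - simpl. rewrite <- IH.
    rewrite (appr_comp_ech P (Nat.iter m P)) by (eapply appr_band; eauto using iter_band).
    apply Cmod_mult.
Qed.

(** Expansion of the powers of [B = P + (B - P)], one factor at a time: by commutation,
    [P^m B^(n+1)] is [P^(m+1) B^n] plus [B - P] applied to [P^m B^n]. The linear prefactor of
    [band_norm] is fixed by the total degree [M] and is paid once, at the end of the expansion, not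
    for every factor. *)
Lemma iter_bound (B P : op) (d : nat) (rho eta : R) :
  appr B -> band d P -> 0 <= rho -> 0 <= eta ->
  (forall x M, bnd x M -> bnd (fun i => (B x i - P x i)%C) (eta * M)) ->
  (forall N j, (2 <= N)%nat -> Cmod (P (ech (root_angle N j)) 0%Z) <= rho) ->
  forall M n m x b, (m + n <= M)%nat -> bnd x b ->
    bnd (Nat.iter m P (Nat.iter n B x))
        (INR (2 * (M * d + 1) + 1) * (rho ^ m * (rho + eta) ^ n * b)).
Proof.
  intros HB HP Hrho Heta HBP Hsym M.
  induction n as [|n IH]; intros m x b Hmn Hx.
  - simpl Nat.iter at 2. assert (Hb := bnd_nonneg _ _ Hx).
    assert (Hm := iter_band d m P HP).
    assert (G := band_norm _ _ (rho ^ m) x b Hm). intros i.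
    eapply Rle_trans; [apply G; [|exact Hx]|].
    + intros j _. rewrite (iter_band_ech d) by exact HP.
      apply pow_incr. split; [apply Cmod_ge_0|apply Hsym; lia].
    + rewrite pow_O, Rmult_1_r. apply Rmult_le_compat_r.
      * apply Rmult_le_pos; [now apply pow_le|exact Hb].
      * apply le_INR. nia.
  - intros i. simpl Nat.iter at 2.
    assert (Hy : bnd (Nat.iter n B x) _) by (apply (IH 0%nat x b); [lia|exact Hx]).
    assert (Hz := IH m x b ltac:(lia) Hx).
    set (y := Nat.iter n B x) in *. set (z := Nat.iter m P y) in *.
    (* Moves the outermost [B] to the front, where it splits into [P] and the error [B - P]. *)
    rewrite (appr_comm (Nat.iter m P) B y _ i (appr_band _ _ (iter_band d m P HP)) HB Hy).
    fold z.
    replace (B z i) with (P z i + (B z i - P z i))%C by ring.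
    eapply Rle_trans; [apply Cmod_triangle|].
    assert (F1 := IH (S m) x b ltac:(lia) Hx i). simpl Nat.iter in F1. fold y z in F1.
    assert (F2 := HBP _ _ Hz i). simpl in F2.
    rewrite <- tech_pow_Rmult in F1. rewrite <- tech_pow_Rmult.
    eapply Rle_trans; [apply Rplus_le_compat; [exact F1|exact F2]|].
    change (M * d + 1 + (M * d + 1 + 0) + 1)%nat with (2 * (M * d + 1) + 1)%nat.
    right. ring.
Qed.

(** With [s = sqrt r], one of the two factors [s ^ n] absorbs the linear growth: Bernoulli's
    inequality for [/ s] bounds [n s^n] by [/ (/ s - 1)]. *)
Lemma affine_times_geometric (A D r : R) :
  0 <= A -> 0 <= D -> 0 < r < 1 ->
  exists Q s, 0 <= Q /\ 0 < s < 1 /\ forall n, (A * INR n + D) * r ^ n <= Q * s ^ n.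
Proof.
  intros HA HD Hr. set (s := sqrt r).
  assert (Hs : 0 < s < 1).
  { split; [apply sqrt_lt_R0; lra|]. rewrite <- sqrt_1. apply sqrt_lt_1_alt. lra. }
  assert (Hss : s * s = r) by (apply sqrt_sqrt; lra).
  assert (Hh : 0 < / s - 1).
  { assert (1 < / s); [|lra]. rewrite <- Rinv_1. apply Rinv_lt_contravar; lra. }
  assert (Hi : 0 <= / (/ s - 1)) by (apply Rlt_le, Rinv_0_lt_compat, Hh).
  exists (A * / (/ s - 1) + D), s. split; [nra|]. split; [exact Hs|]. intros n.
  assert (Hp : 0 < s ^ n) by (apply pow_lt; lra).
  assert (Hp1 : s ^ n <= 1) by (rewrite <- (pow1 n); apply pow_incr; lra).
  assert (G : INR n * s ^ n <= / (/ s - 1)).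
  { assert (H1 := poly n (/ s - 1) Hh).
    replace (1 + (/ s - 1)) with (/ s) in H1 by ring. rewrite pow_inv in H1.
    apply Rmult_le_reg_r with (/ s - 1); [exact Hh|]. rewrite Rinv_l by lra.
    assert (s ^ n * / s ^ n = 1) by (apply Rinv_r; lra). nra. }
  rewrite <- Hss, Rpow_mult_distr.
  assert (A * (INR n * s ^ n) <= A * / (/ s - 1)) by (apply Rmult_le_compat_l; assumption).
  assert (D * s ^ n <= D) by nra.
  replace ((A * INR n + D) * (s ^ n * s ^ n))
    with ((A * (INR n * s ^ n) + D * s ^ n) * s ^ n) by ring.
  apply Rmult_le_compat_r; lra.
Qed.

Lemma is_series_geom_shift (M s : R) (n : nat) :
  0 < s < 1 -> is_series (fun k => M * s ^ (n + k)) (M * s ^ n / (1 - s)).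
Proof.
  intros Hs.
  assert (G := is_series_scal_l (K := R_AbsRing) (V := R_NormedModule)
                 (M * s ^ n) _ _ (is_series_geom s ltac:(rewrite Rabs_pos_eq; lra))).
  eapply is_series_ext; [|exact G]. intros k. rewrite pow_add.
  unfold scal; simpl; unfold mult; simpl. ring.
Qed.

Lemma geometric_vanishes (E s x : R) :
  0 < s < 1 -> (forall n : nat, x <= E * s ^ n) -> x <= 0.
Proof.
  intros Hs Hx. apply le_epsilon. intros eps He. rewrite Rplus_0_l.
  destruct (small_factor (Rabs E) eps (Rabs_pos E) He) as (e & He' & Hse).
  destruct (pow_lt_1_zero s ltac:(rewrite Rabs_pos_eq; lra) e He') as [N HN].
  specialize (HN N (le_n N)). specialize (Hx N).
  assert (0 < s ^ N) by (apply pow_lt; lra).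
  rewrite Rabs_pos_eq in HN by lra.
  generalize (Rle_abs E) (Rabs_pos E). nra.
Qed.

(** The series is defined pointwise, but its tails are small uniformly in [i]. This uniformity is
    essential: [B] is continuous for the sup norm, not for pointwise convergence. *)
Lemma neumann (B : op) (Q s : R) :
  appr B -> 0 < s < 1 ->
  (forall n x b, bnd x b -> bnd (Nat.iter n B x) (Q * s ^ n * b)) ->
  forall y b, bnd y b -> exists x M, bnd x M /\ forall i, (x i - B x i)%C = y i.
Proof.
  intros HB Hs HQ y b Hy.
  set (x := fun i => cseries (fun n => Nat.iter n B y i)).
  set (S := fun n i => csum n (fun k => Nat.iter k B y i)).
  set (E := 2 * (Q * b / (1 - s))).
  assert (Ht : forall n, bnd (fun i => (x i - S n i)%C) (E * s ^ n)).
  { intros n i.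
    assert (Hd : forall m, Cmod (Nat.iter m B y i) <= Q * b * s ^ m).
    { intros m. generalize (HQ m y b Hy i). lra. }
    eapply Rle_trans.
    - apply (cseries_tail _ (fun k => Q * b * s ^ k)); [exact Hd|].
      eexists. exact (is_series_geom_shift (Q * b) s 0 Hs).
    - rewrite (is_series_unique _ _ (is_series_geom_shift (Q * b) s n Hs)). unfold E.
      right. field. lra. }
  assert (Hx : bnd x E).
  { intros i. generalize (Ht 0%nat i). unfold S; simpl.
    replace (x i - 0)%C with (x i) by ring. lra. }
  assert (HS : forall n, bnd (S n) (E + E * s ^ n)).
  { intros n i. replace (S n i) with (x i - (x i - S n i))%C by ring.
    eapply Rle_trans; [apply Cmod_minus_le|]. generalize (Hx i) (Ht n i). simpl. lra. }
  assert (HBS : forall n i, B (S n) i = (S (Datatypes.S n) i - y i)%C).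
  { induction n as [|n IH]; intros i.
    - unfold S; simpl. rewrite appr_zero_arg by exact HB. ring.
    - transitivity (B (S n) i + B (Nat.iter n B y) i)%C.
      + exact (appr_add_arg B _ _ _ _ i HB (HS n) (HQ n y b Hy)).
      + rewrite IH. unfold S. cbn [csum]. simpl Nat.iter. ring. }
  destruct (appr_bounded B HB) as (K & HK & BK).
  exists x, E. split; [exact Hx|]. intros i. apply Ceq_of_Cmod_small. intros eps He.
  enough (G : Cmod (x i - B x i - y i)%C <= 0) by lra.
  apply (geometric_vanishes (E + K * E) s); [exact Hs|]. intros n.
  (* As [B S_n = S_(n+1) - y], the residual consists of two tails only. *)
  replace (x i - B x i - y i)%C
    with ((x i - S (Datatypes.S n) i) - (B x i - B (S n) i))%C by (rewrite HBS; ring).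
  rewrite <- (appr_sub_arg B x (S n) _ _ i HB Hx (HS n)).
  eapply Rle_trans; [apply Cmod_minus_le|].
  generalize (Ht (Datatypes.S n) i) (BK _ _ (Ht n) i).
  assert (0 <= E) by (apply Rle_trans with (2 := Hx 0%Z); apply Cmod_ge_0).
  assert (0 < s ^ n) by (apply pow_lt; lra).
  assert (E * (s * s ^ n) <= E * s ^ n) by (apply Rmult_le_compat_l; nra).
  simpl. lra.
Qed.

(* [1 - T* T / K^2] has symbol at most [rho < 1] at roots of unity; up to an error [eta] in
   norm it is a band operator [P], and the norm of [P^n] exceeds the supremum of its symbol
   by a factor that is only linear in [n].  Hence the Neumann series converges. *)
Lemma wiener (T : op) (c : R) :
  appr T -> 0 < c ->
  (forall N j, (2 <= N)%nat -> c <= Cmod (T (ech (root_angle N j)) 0%Z)) ->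
  (forall x M, bnd x M -> (forall i, T x i = RtoC 0) -> forall i, x i = RtoC 0) /\
  (forall y M, bnd y M -> exists x M', bnd x M' /\ forall i, T x i = y i).
Proof.
  intros HT Hc Hsym.
  destruct (appr_bounded T HT) as (K & HK & BK).
  (* Normalises by the norm bound [K], so that [kap |symbol|^2 <= 1] and the symbol
     [1 - kap |symbol|^2] of [B] is nonnegative. *)
  set (kap := / (K * K)).
  assert (HKK : 0 < K * K) by nra.
  assert (Hkap : 0 < kap) by (apply Rinv_0_lt_compat; exact HKK).
  assert (HkK : kap * (K * K) = 1) by (apply Rinv_l; lra).
  assert (HA := appr_adj T HT).
  assert (HW := appr_comp _ _ HT HA).
  assert (HB := appr_plus _ _ appr_id (appr_scal (RtoC (- kap)) _ HW)).
  set (B := fun x i => (x i + RtoC (- kap) * T (adj T x) i)%C) in HB.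
  assert (Hcon : forall t, Cmod (T (ech t) 0%Z) <= K).
  { intros t. generalize (BK _ _ (ech_bnd t) 0%Z). lra. }
  assert (HcK : c <= K) by (apply Rle_trans with (2 := Hcon (root_angle 2 0)); apply Hsym; lia).
  assert (Hkc : kap * (c * c) <= 1) by (rewrite <- HkK; apply Rmult_le_compat_l; nra).
  assert (Hkc0 : 0 < kap * (c * c)) by (apply Rmult_lt_0_compat; nra).
  set (rho := 1 - kap * (c * c)).
  (* A third of the gap [1 - rho]: [eta] is lost twice, once in the symbol of [P] and once in
     [iter_bound], and [rho + 2 eta] must stay below [1]. *)
  set (eta := kap * (c * c) / 3).
  assert (HBs : forall N j, (2 <= N)%nat -> Cmod (B (ech (root_angle N j)) 0%Z) <= rho).
  { intros N j HN. unfold B. rewrite (appr_comp_ech T (adj T)), adj_ech, ech_0 by assumption.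
    rewrite <- Cmod2_conj, <- RtoC_mult, <- RtoC_plus, Cmod_R.
    generalize (Hsym N j HN) (Hcon (root_angle N j)).
    set (t := Cmod (T (ech (root_angle N j)) 0%Z)). intros H1 H2.
    assert (kap * (t * t) <= 1) by (rewrite <- HkK; apply Rmult_le_compat_l; nra).
    assert (kap * (c * c) <= kap * (t * t)) by (apply Rmult_le_compat_l; nra).
    unfold rho. rewrite Rabs_pos_eq; simpl; lra. }
  destruct (HB eta) as (d & P & HP & HE); [unfold eta; lra|].
  assert (HPs : forall N j, (2 <= N)%nat -> Cmod (P (ech (root_angle N j)) 0%Z) <= rho + eta).
  { intros N j HN. generalize (HBs N j HN) (HE _ _ (ech_bnd (root_angle N j)) 0%Z).
    simpl. set (p := P _ _). set (q := B _ _). intros H1 H2.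
    replace p with (q - (q - p))%C by ring. generalize (Cmod_minus_le q (q - p)%C). lra. }
  assert (Hit := iter_bound B P d (rho + eta) eta HB HP ltac:(unfold rho, eta; lra)
                   ltac:(unfold eta; lra) HE HPs).
  destruct (affine_times_geometric (2 * INR d) 3 (rho + eta + eta)) as (Q & s & HQ & Hs & HQs).
  { generalize (pos_INR d). lra. }
  { lra. }
  { unfold rho, eta; lra. }
  assert (HQB : forall n x b, bnd x b -> bnd (Nat.iter n B x) (Q * s ^ n * b)).
  { intros n x b Hx i. generalize (Hit n n 0%nat x b (le_n n) Hx i). simpl Nat.iter.
    intros H1. eapply Rle_trans; [exact H1|].
    replace (INR (2 * (n * d + 1) + 1)) with (2 * INR d * INR n + 3)
      by (rewrite !plus_INR, mult_INR, plus_INR, mult_INR; simpl; ring).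
    generalize (HQs n) (bnd_nonneg _ _ Hx). simpl pow. nra. }
  split.
  - intros x M Hx H0.
    (* A kernel vector of [T] is fixed by [B], because [T] commutes with its adjoint; the geometric
       decay of the powers of [B] then forces it to vanish. *)
    assert (HBx : B x = x).
    { apply functional_extensionality; intros i. unfold B.
      rewrite (appr_comm T (adj T) x M i HT HA Hx).
      replace (T x) with (fun _ : Z => RtoC 0)
        by (apply functional_extensionality; intros; now rewrite H0).
      rewrite (appr_zero_arg (adj T)) by exact HA. ring. }
    assert (Hix : forall n, Nat.iter n B x = x).
    { induction n as [|n IH]; [reflexivity|]. simpl. now rewrite IH. }
    intros i. apply Cmod_eq_0. apply Rle_antisym; [|apply Cmod_ge_0].
    apply (geometric_vanishes (Q * M) s _ Hs). intros n.
    generalize (HQB n x M Hx i). rewrite Hix. lra.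
  - intros y M Hy.
    destruct (neumann B Q s HB Hs HQB y M Hy) as (x & M' & Hx & Ex).
    (* The equation [x - B x = y] reads [kap T (adj T x) = y], so [kap adj T x] is a preimage of
       [y]. *)
    destruct (appr_bounded _ HA) as (K' & HK' & BK').
    exists (fun i => (RtoC kap * adj T x i)%C), (Cmod (RtoC kap) * (K' * M')). split.
    + apply bnd_scal. now apply BK'.
    + intros i. rewrite (appr_scal_arg T _ (adj T x) (K' * M')) by auto.
      rewrite <- Ex. unfold B. rewrite RtoC_opp. ring.
Qed.

(** * Absolutely convergent sums over the integers *)

Definition sumR (g : Z -> R) : Prop :=
  ex_series (fun n => g (Z.of_nat n)) /\ ex_series (fun n => g (- Z.of_nat (S n))%Z).

Lemma sumR_dominated (g b : Z -> R) : (forall k, Rabs (g k) <= b k) -> sumR b -> sumR g.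
Proof.
  intros Hg [H1 H2]. split.
  - apply ex_series_dominated with (2 := H1). intros; apply Hg.
  - apply ex_series_dominated with (2 := H2). intros; apply Hg.
Qed.

Lemma ex_series_ext_R (a b : nat -> R) :
  (forall n, a n = b n) -> ex_series a -> ex_series b.
Proof. apply (ex_series_ext (K := R_AbsRing) (V := R_NormedModule)). Qed.

Lemma ex_series_S (a : nat -> R) : ex_series a <-> ex_series (fun k => a (S k)).
Proof. apply (ex_series_incr_1 (K := R_AbsRing) (V := R_NormedModule)). Qed.

Lemma sumR_opp (g : Z -> R) : sumR g -> sumR (fun k => g (- k)%Z).
Proof.
  intros [H1 H2]. split.
  - apply ex_series_S. exact H2.
  - apply ex_series_S in H1. eapply ex_series_ext_R; [|exact H1].
    intros n. simpl. f_equal.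
Qed.

Lemma Zsum_opp (g : Z -> R) : sumR g -> Zsum (fun k => g (- k)%Z) = Zsum g.
Proof.
  intros Hg. destruct (sumR_opp g Hg) as [H3 H4]. destruct Hg as [H1 H2]. unfold Zsum.
  (* The term at [0] belongs to the nonnegative half of [Zsum], so it is split off before the halves
     are exchanged. *)
  rewrite (Series_incr_1 _ H3), (Series_incr_1 _ H1).
  rewrite (Series_ext (fun n => g (- - Z.of_nat (S n))%Z) (fun k => g (Z.of_nat (S k)))).
  - simpl. ring.
  - intros n. now rewrite Z.opp_involutive.
Qed.

Lemma sumR_shift1 (g : Z -> R) : sumR g -> sumR (fun k => g (k + 1)%Z).
Proof.
  intros [H1 H2]. split.
  - apply ex_series_S in H1. eapply ex_series_ext_R; [|exact H1].
    intros n. cbv beta. f_equal. lia.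
  - apply ex_series_S. eapply ex_series_ext_R; [|exact H2].
    intros n. cbv beta. f_equal. lia.
Qed.

Lemma Zsum_shift1 (g : Z -> R) : sumR g -> Zsum (fun k => g (k + 1)%Z) = Zsum g.
Proof.
  intros Hg. destruct (sumR_shift1 g Hg) as [H3 H4]. destruct Hg as [H1 H2]. unfold Zsum.
  rewrite (Series_incr_1 _ H1), (Series_incr_1 _ H4).
  rewrite (Series_ext (fun n => g (Z.of_nat n + 1)%Z) (fun k => g (Z.of_nat (S k))))
    by (intros; f_equal; lia).
  rewrite (Series_ext (fun n => g (- Z.of_nat (S (S n)) + 1)%Z)
                      (fun n => g (- Z.of_nat (S n))%Z)) by (intros; f_equal; lia).
  simpl. ring.
Qed.

Lemma Zsum_shift_nat (g : Z -> R) (n : nat) :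
  sumR g -> sumR (fun k => g (k + Z.of_nat n)%Z) /\ Zsum (fun k => g (k + Z.of_nat n)%Z) = Zsum g.
Proof.
  intros Hg. induction n as [|n [IH1 IH2]].
  - replace (fun k => g (k + Z.of_nat 0)%Z) with g; [now split|].
    apply functional_extensionality; intros; f_equal; lia.
  - replace (fun k => g (k + Z.of_nat (S n))%Z) with (fun k => g ((k + 1) + Z.of_nat n)%Z)
      by (apply functional_extensionality; intros; f_equal; lia).
    split.
    + exact (sumR_shift1 _ IH1).
    + rewrite (Zsum_shift1 (fun k => g (k + Z.of_nat n)%Z)) by exact IH1. exact IH2.
Qed.

Lemma Zsum_reflect (g : Z -> R) (i : Z) :
  sumR g -> sumR (fun k => g (i - k)%Z) /\ Zsum (fun k => g (i - k)%Z) = Zsum g.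
Proof.
  intros Hg. assert (Hg' := sumR_opp g Hg).
  (* Shifts are available by naturals only: for [i >= 0] shift and then reflect, for [i < 0] reflect
     first. *)
  destruct (Z_le_gt_dec 0 i) as [Hi|Hi].
  - destruct (Zsum_shift_nat g (Z.to_nat i) Hg) as [S1 S2]. rewrite Z2Nat.id in * by lia.
    assert (S3 := sumR_opp _ S1). assert (S4 := Zsum_opp _ S1). simpl in *.
    replace (fun k => g (i - k)%Z) with (fun k => g (- k + i)%Z)
      by (apply functional_extensionality; intros; f_equal; lia).
    split; [exact S3|]. now rewrite S4, S2.
  - destruct (Zsum_shift_nat _ (Z.to_nat (- i)) Hg') as [S1 S2]. rewrite Z2Nat.id in * by lia.
    replace (fun k => g (i - k)%Z) with (fun k => g (- (k + - i))%Z)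
      by (apply functional_extensionality; intros; f_equal; lia).
    split; [exact S1|]. rewrite S2. now apply Zsum_opp.
Qed.

Definition summable (f : Z -> C) : Prop := sumR (fun k => Cmod (f k)).

Lemma summable_dominated (f : Z -> C) (b : Z -> R) :
  (forall k, Cmod (f k) <= b k) -> sumR b -> summable f.
Proof.
  intros Hf. apply sumR_dominated. intros k. rewrite Rabs_pos_eq by apply Cmod_ge_0. apply Hf.
Qed.

Lemma sumR_scal_r (b : Z -> R) (M : R) : sumR b -> sumR (fun k => b k * M).
Proof. intros [H1 H2]. split; now apply ex_series_scal_r. Qed.

Lemma summable_mult_bnd (f x : Z -> C) (M : R) :
  summable f -> bnd x M -> summable (fun k => (f k * x k)%C).
Proof.
  intros Hf Hx. apply summable_dominated with (fun k => Cmod (f k) * M).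
  - intros k. rewrite Cmod_mult. apply Rmult_le_compat_l; [apply Cmod_ge_0|apply Hx].
  - now apply sumR_scal_r.
Qed.

Lemma summable_reflect (f : Z -> C) (i : Z) : summable f -> summable (fun j => f (i - j)%Z).
Proof. intros Hf. exact (proj1 (Zsum_reflect (fun k => Cmod (f k)) i Hf)). Qed.

Lemma sumR_fst (f : Z -> C) : summable f -> sumR (fun k => fst (f k)).
Proof. apply sumR_dominated. intros; apply Rabs_fst_le. Qed.

Lemma sumR_snd (f : Z -> C) : summable f -> sumR (fun k => snd (f k)).
Proof. apply sumR_dominated. intros; apply Rabs_snd_le. Qed.

Lemma CZsum_ext (f g : Z -> C) : (forall k, f k = g k) -> CZsum f = CZsum g.
Proof. intros E. f_equal. now apply functional_extensionality. Qed.

Lemma CZsum_reflect (f : Z -> C) (i : Z) :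
  summable f -> CZsum (fun j => f (i - j)%Z) = CZsum f.
Proof.
  intros Hf. unfold CZsum. f_equal.
  - exact (proj2 (Zsum_reflect _ i (sumR_fst f Hf))).
  - exact (proj2 (Zsum_reflect _ i (sumR_snd f Hf))).
Qed.

(** The window runs from [-K] to [K - 1]. Its asymmetry is useful: the window for [K * N] splits
    exactly into [N] residue classes, each with its own window for [K]. *)
Definition psum (K : nat) (g : Z -> C) : C :=
  (csum K (fun n => g (Z.of_nat n)) + csum K (fun n => g (- Z.of_nat (S n))%Z))%C.

Lemma Series_tail_small (b : nat -> R) :
  ex_series b -> forall eps, 0 < eps ->
  exists N, forall n, (N <= n)%nat -> Series (fun k => b (n + k)%nat) <= eps.
Proof.
  intros Hb eps He. assert (Hl := Series_correct b Hb).
  apply (is_lim_seq_spec (sum_n b) (Series b)) in Hl.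
  destruct (Hl (mkposreal eps He)) as [N HN]. simpl in HN.
  exists (S N). intros n Hn. specialize (HN (pred n) ltac:(lia)).
  rewrite (Series_incr_n b n) in HN by (auto; lia). rewrite sum_n_Reals in HN.
  apply Rabs_lt_between in HN. lra.
Qed.

(** The threshold depends on [f] alone and serves every [g] dominated by a multiple of [f]. This
    uniformity makes truncation of a Laurent operator converge in operator norm. *)
Lemma CZsum_approx (f : Z -> C) :
  summable f -> forall eps, 0 < eps -> exists K0, forall K, (K0 <= K)%nat ->
  forall g M, (forall k, Cmod (g k) <= Cmod (f k) * M) ->
  0 <= M -> Cmod (CZsum g - psum K g)%C <= eps * M.
Proof.
  intros [H1 H2] eps He.
  (* There are two half-series, each with the factor [2] of [cseries_tail]. *)
  destruct (Series_tail_small _ H1 (eps / 4)) as [N1 HN1]; [lra|].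
  destruct (Series_tail_small _ H2 (eps / 4)) as [N2 HN2]; [lra|].
  exists (N1 + N2)%nat. intros K HK g M Hg HM.
  change (CZsum g) with
    (cseries (fun n => g (Z.of_nat n)) + cseries (fun n => g (- Z.of_nat (S n))%Z))%C.
  unfold psum.
  set (u := fun n => g (Z.of_nat n)). set (v := fun n => g (- Z.of_nat (S n))%Z).
  replace (cseries u + cseries v - (csum K u + csum K v))%C
    with ((cseries u - csum K u) + (cseries v - csum K v))%C by ring.
  eapply Rle_trans; [apply Cmod_triangle|].
  assert (A1 := cseries_tail u (fun n => Cmod (f (Z.of_nat n)) * M) K
                  (fun n => Hg _) (ex_series_scal_r M _ H1)).
  assert (A2 := cseries_tail v (fun n => Cmod (f (- Z.of_nat (S n))%Z) * M) K
                  (fun n => Hg _) (ex_series_scal_r M _ H2)).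
  cbv beta in A1, A2. rewrite Series_scal_r in A1, A2.
  generalize (HN1 K ltac:(lia)) (HN2 K ltac:(lia)). intros B1 B2.
  set (s1 := Series _) in A1, B1. set (s2 := Series _) in A2, B2. nra.
Qed.

(** Closeness along arbitrarily large [K] suffices, so the window may be restricted to multiples of
    a period. *)
Lemma CZsum_unique (f : Z -> C) (z : C) :
  summable f ->
  (forall eps K0, 0 < eps -> exists K, (K0 <= K)%nat /\ Cmod (psum K f - z)%C <= eps) ->
  CZsum f = z.
Proof.
  intros Hf Hz. apply Ceq_of_Cmod_small. intros eps He.
  destruct (CZsum_approx f Hf (eps / 2)) as [K0 HK0]; [lra|].
  destruct (Hz (eps / 2) K0) as (K & HK & E); [lra|].
  specialize (HK0 K HK f 1 (fun k => Req_le _ _ (eq_sym (Rmult_1_r _))) Rle_0_1).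
  generalize (Cmod_dist_triangle (CZsum f) (psum K f) z). lra.
Qed.

Lemma CZsum_plus (f g : Z -> C) :
  summable f -> summable g -> CZsum (fun k => (f k + g k)%C) = (CZsum f + CZsum g)%C.
Proof.
  intros Hf Hg.
  assert (P : forall u v, sumR u -> sumR v -> Zsum (fun k => u k + v k) = Zsum u + Zsum v).
  { intros u v [U1 U2] [V1 V2]. unfold Zsum.
    rewrite (Series_plus _ _ U1 V1), (Series_plus _ _ U2 V2). ring. }
  unfold CZsum, Cplus; simpl. f_equal; apply P; auto using sumR_fst, sumR_snd.
Qed.

(** * Laurent operators *)

Definition laurent (f : Z -> C) : op := fun x i => CZsum (fun j => (f (i - j)%Z * x j)%C).

(** Puts the summation index on the coefficients; truncating this form gives band operators. *)
Lemma laurent_reindex (f x : Z -> C) (M : R) (i : Z) :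
  summable f -> bnd x M -> laurent f x i = CZsum (fun k => (f k * x (i - k)%Z)%C).
Proof.
  intros Hf Hx.
  rewrite <- (CZsum_reflect (fun k => (f k * x (i - k)%Z)%C) i).
  - apply CZsum_ext. intros j. do 2 f_equal. ring.
  - apply summable_mult_bnd with M; [exact Hf|]. intros k. apply Hx.
Qed.

Lemma band_csum (d n : nat) (T : nat -> op) :
  (forall k, (k < n)%nat -> band d (T k)) -> band d (fun x i => csum n (fun k => T k x i)).
Proof.
  induction n as [|n IH]; intros HT; [apply band_zero|].
  apply (band_plus d (fun x i => csum n (fun k => T k x i)) (T n)).
  - apply IH. intros; apply HT; lia.
  - apply HT; lia.
Qed.

Lemma appr_laurent (f : Z -> C) : summable f -> appr (laurent f).
Proof.
  intros Hf eps He. destruct (CZsum_approx f Hf eps He) as [K HK].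
  exists K, (fun x i => psum K (fun k => (f k * x (i - k)%Z)%C)). split.
  - unfold psum. apply (band_plus K
      (fun x i => csum K (fun n => (f (Z.of_nat n) * x (i - Z.of_nat n)%Z)%C))
      (fun x i => csum K (fun n => (f (- Z.of_nat (S n))%Z * x (i - - Z.of_nat (S n))%Z)%C))).
    + apply (band_csum K K (fun n x i => (f (Z.of_nat n) * x (i - Z.of_nat n)%Z)%C)).
      intros k Hk. apply band_shift. lia.
    + apply (band_csum K K
        (fun n x i => (f (- Z.of_nat (S n))%Z * x (i - - Z.of_nat (S n))%Z)%C)).
      intros k Hk. apply band_shift. lia.
  - intros x M Hx i. rewrite (laurent_reindex f x M i Hf Hx).
    apply HK; [exact (le_n K)| |exact (bnd_nonneg _ _ Hx)].
    intros k. rewrite Cmod_mult. apply Rmult_le_compat_l; [apply Cmod_ge_0|apply Hx].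
Qed.

Definition symb (f : Z -> C) (t : R) : C := CZsum (fun k => (f k * ech t k)%C).

(** The shift by [k] multiplies a character by [ech t (- k)], hence the angle [- t]; for circulants,
    indexed by column minus row, the angle is [t]. *)
Lemma laurent_ech (f : Z -> C) (t : R) :
  summable f -> laurent f (ech t) 0%Z = symb f (- t).
Proof.
  intros Hf. rewrite (laurent_reindex f (ech t) 1 0 Hf (ech_bnd t)).
  apply CZsum_ext. intros k. unfold ech. do 2 f_equal. rewrite minus_IZR. ring.
Qed.

(** * Periodization *)

(** The sign of [k] is that of [omega_p]; [periodize_alt] reverses it. *)
Definition periodize (f : Z -> C) (N : nat) (m : Z) : C :=
  CZsum (fun k => f (m - k * Z.of_nat N)%Z).

Lemma ex_series_bounded (a : nat -> R) (M : R) :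
  (forall n, 0 <= a n) -> (forall n, sum_n a n <= M) -> ex_series a.
Proof.
  intros Ha HM. apply ex_finite_lim_seq_incr with M; [|exact HM].
  intros n. rewrite sum_Sn. unfold plus; simpl. generalize (Ha (S n)). lra.
Qed.

Lemma sum_n_mono (b : nat -> R) (m n : nat) :
  (forall k, 0 <= b k) -> (m <= n)%nat -> sum_n b m <= sum_n b n.
Proof.
  intros Hb. induction 1 as [|n _ IH]; [lra|].
  rewrite sum_Sn. unfold plus; simpl. generalize (Hb (S n)). lra.
Qed.

(** As [phi] is increasing and the terms are nonnegative, the partial sum of the subseries at [n] is
    at most that of [b] at [phi n]. *)
Lemma ex_series_subseries (b : nat -> R) (phi : nat -> nat) :
  (forall k, 0 <= b k) -> (forall k, (phi k < phi (S k))%nat) ->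
  ex_series b -> ex_series (fun k => b (phi k)).
Proof.
  intros Hb Hphi Hs. apply ex_series_bounded with (Series b); [intros; apply Hb|].
  assert (Hle : forall n, sum_n b n <= Series b).
  { intros n. apply (is_lim_seq_incr_compare (sum_n b)).
    - exact (Series_correct b Hs).
    - intros m. apply sum_n_mono; [exact Hb|lia]. }
  intros n. apply Rle_trans with (2 := Hle (phi n)). induction n as [|n IH].
  - rewrite sum_O. destruct (phi O) as [|p]; [rewrite sum_O; lra|].
    rewrite sum_Sn. unfold plus; simpl.
    assert (H0 := sum_n_mono b 0 p Hb ltac:(lia)). rewrite sum_O in H0.
    generalize (Hb O). lra.
  - specialize (Hphi n). rewrite sum_Sn. unfold plus; simpl.
    destruct (phi (S n)) as [|p]; [lia|]. rewrite sum_Sn. unfold plus; simpl.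
    assert (H0 := sum_n_mono b (phi n) p Hb ltac:(lia)). lra.
Qed.

Lemma summable_progression (f : Z -> C) (N n : nat) :
  (n < N)%nat -> summable f -> summable (fun k => f (Z.of_nat n + k * Z.of_nat N)%Z).
Proof.
  intros Hn [H1 H2]. split.
  - apply (ex_series_ext_R (fun k => Cmod (f (Z.of_nat (n + k * N))))).
    + intros k. do 2 f_equal. nia.
    + apply (ex_series_subseries (fun k => Cmod (f (Z.of_nat k))) (fun k => (n + k * N)%nat));
        [intros; apply Cmod_ge_0|intros; lia|exact H1].
  (* The term with index [- (k + 1)] sits at [n - (k + 1) N], that is at [- S (k N + (N - n - 1))];
     [n < N] keeps the subtraction honest. *)
  - apply (ex_series_ext_R (fun k => Cmod (f (- Z.of_nat (S (k * N + (N - n - 1))))%Z))).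
    + intros k. do 2 f_equal. nia.
    + apply (ex_series_subseries (fun k => Cmod (f (- Z.of_nat (S k))%Z))
               (fun k => (k * N + (N - n - 1))%nat));
        [intros; apply Cmod_ge_0|intros; lia|exact H2].
Qed.

Lemma periodize_alt (f : Z -> C) (N n : nat) :
  (n < N)%nat -> summable f ->
  periodize f N (Z.of_nat n) = CZsum (fun k => f (Z.of_nat n + k * Z.of_nat N)%Z).
Proof.
  intros Hn Hf. rewrite <- (CZsum_reflect _ 0 (summable_progression f N n Hn Hf)).
  apply CZsum_ext. intros k. f_equal. ring.
Qed.

Lemma ech_periodic (N : nat) (t : R) (m k : Z) :
  cis (INR N * t) = RtoC 1 -> ech t (m + k * Z.of_nat N) = ech t m.
Proof.
  intros HN. unfold ech. rewrite plus_IZR, mult_IZR, <- INR_IZR_INZ, Rmult_plus_distr_r, cis_plus.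
  enough (E : cis (IZR k * INR N * t) = RtoC 1) by (rewrite E; ring).
  rewrite Rmult_assoc. destruct (Z_le_gt_dec 0 k) as [Hk|Hk].
  - rewrite <- (Z2Nat.id k) by lia. rewrite <- INR_IZR_INZ. now apply cis_mult_nat.
  - rewrite <- (Z.opp_involutive k), opp_IZR, Ropp_mult_distr_l_reverse, cis_opp.
    rewrite <- (Z2Nat.id (- k)) by lia. rewrite <- INR_IZR_INZ, cis_mult_nat by exact HN.
    unfold Cconj, RtoC; simpl. f_equal; ring.
Qed.

Lemma eventually_forall_lt (N : nat) (P : nat -> nat -> Prop) :
  (forall n, (n < N)%nat -> exists K0, forall K, (K0 <= K)%nat -> P n K) ->
  exists K0, forall K, (K0 <= K)%nat -> forall n, (n < N)%nat -> P n K.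
Proof.
  induction N as [|N IH]; intros HP.
  - exists O. intros; lia.
  - destruct IH as [K1 HK1]; [intros; apply HP; lia|].
    destruct (HP N ltac:(lia)) as [K2 HK2].
    exists (K1 + K2)%nat. intros K HK n Hn.
    destruct (Nat.eq_dec n N) as [->|]; [apply HK2; lia|apply HK1; lia].
Qed.

Lemma psum_blocks (N K : nat) (f : Z -> C) (t : R) :
  cis (INR N * t) = RtoC 1 ->
  psum (K * N) (fun k => (f k * ech t k)%C)
  = csum N (fun n => (psum K (fun k => f (Z.of_nat n + k * Z.of_nat N)%Z)
                      * ech t (Z.of_nat n))%C).
Proof.
  intros HN. unfold psum. rewrite !csum_mult.
  rewrite (csum_ext K (fun k => csum N (fun n =>
     (f (- Z.of_nat (S (k * N + n)))%Z * ech t (- Z.of_nat (S (k * N + n)))%Z)%C))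
    (fun k => csum N (fun n => (ech t (Z.of_nat n)
                               * f (Z.of_nat n + - Z.of_nat (S k) * Z.of_nat N)%Z)%C))).
  2:{ intros k _. rewrite csum_rev. apply csum_ext. intros n Hn.
      replace (- Z.of_nat (S (k * N + (N - 1 - n))))%Z
        with (Z.of_nat n + - Z.of_nat (S k) * Z.of_nat N)%Z by nia.
      rewrite (ech_periodic N) by exact HN. ring. }
  rewrite (csum_ext K (fun k => csum N (fun n =>
     (f (Z.of_nat (k * N + n)) * ech t (Z.of_nat (k * N + n)))%C))
    (fun k => csum N (fun n => (ech t (Z.of_nat n)
                               * f (Z.of_nat n + Z.of_nat k * Z.of_nat N)%Z)%C))).
  2:{ intros k _. apply csum_ext. intros n Hn.
      replace (Z.of_nat (k * N + n)) with (Z.of_nat n + Z.of_nat k * Z.of_nat N)%Z by nia.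
      rewrite (ech_periodic N) by exact HN. ring. }
  rewrite !(csum_swap K N), <- csum_plus. apply csum_ext. intros n _.
  rewrite !csum_scal. ring.
Qed.

(** Discrete Poisson summation: at an [N]-th root of unity the character depends only on the residue
    mod [N], so summing the series by residue classes yields the periodized coefficients. *)
Lemma periodize_symb (f : Z -> C) (N : nat) (t : R) :
  summable f -> cis (INR N * t) = RtoC 1 -> (0 < N)%nat ->
  csum N (fun n => (periodize f N (Z.of_nat n) * ech t (Z.of_nat n))%C) = symb f t.
Proof.
  intros Hf HN HN0. symmetry. apply CZsum_unique.
  { apply summable_mult_bnd with 1; [exact Hf|apply ech_bnd]. }
  intros eps K0 He.
  assert (HNpos : 0 < INR N) by (apply lt_0_INR; lia).
  destruct (small_factor (INR N) eps) as (e & He' & Hs); [lra|exact He|].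
  destruct (eventually_forall_lt N (fun n K =>
    Cmod (psum K (fun k => f (Z.of_nat n + k * Z.of_nat N)%Z) - periodize f N (Z.of_nat n))%C
      <= e)) as [K1 HK1].
  { intros n Hn. assert (Hp := summable_progression f N n Hn Hf).
    destruct (CZsum_approx _ Hp e He') as [K1 HK1]. exists K1. intros K HK.
    rewrite Cmod_minus_sym, (periodize_alt f N n Hn Hf), <- (Rmult_1_r e).
    apply HK1; [exact HK|intros; lra|lra]. }
  exists ((K0 + K1) * N)%nat. split; [nia|].
  rewrite (psum_blocks N _ f t HN), <- csum_minus.
  apply Rle_trans with (INR N * e); [|lra]. apply Cmod_csum_le. intros n Hn.
  match goal with |- Cmod ?z <= _ => replace z with
   ((psum (K0 + K1) (fun k => f (Z.of_nat n + k * Z.of_nat N)%Z) - periodize f N (Z.of_nat n))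
    * ech t (Z.of_nat n))%C by ring end.
  rewrite Cmod_mult. assert (H1 : Cmod (ech t (Z.of_nat n)) = 1) by apply Cmod_cis.
  rewrite H1, Rmult_1_r. apply HK1; [lia|exact Hn].
Qed.

(** * Two by two systems *)

(** Half-angle formulas: the components are [sqrt ((r + x) / 2)] and [sqrt ((r - x) / 2)], the
    latter with the sign of [y]. *)
Lemma Csqrt_exists (z : C) : exists w : C, (w * w)%C = z.
Proof.
  destruct z as [x y]. set (r := Cmod (x, y)).
  assert (Hr : r * r = x * x + y * y).
  { unfold r, Cmod; simpl fst; simpl snd. rewrite sqrt_sqrt; nra. }
  assert (Hr0 : 0 <= r) by apply Cmod_ge_0.
  assert (Hx : Rabs x <= r) by (apply (Rabs_fst_le (x, y))).
  assert (Hx' := Rle_abs x). assert (Hx'' := Rle_abs (- x)). rewrite Rabs_Ropp in Hx''.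
  set (u := sqrt ((r + x) / 2)). set (v := sqrt ((r - x) / 2)).
  assert (Hu : u * u = (r + x) / 2) by (apply sqrt_sqrt; lra).
  assert (Hv : v * v = (r - x) / 2) by (apply sqrt_sqrt; lra).
  assert (Huv : 2 * (u * v) = Rabs y).
  { unfold u, v. rewrite <- sqrt_mult by lra.
    replace ((r + x) / 2 * ((r - x) / 2)) with ((y / 2) ^ 2).
    - rewrite <- (pow2_abs (y / 2)), sqrt_pow2 by apply Rabs_pos.
      unfold Rdiv. rewrite Rabs_mult, (Rabs_pos_eq (/ 2)) by lra. lra.
    - replace ((r + x) / 2 * ((r - x) / 2)) with ((r * r - x * x) / 4) by field.
      rewrite Hr. field. }
  destruct (Rle_dec 0 y) as [Hy|Hy].
  - exists (u, v). rewrite Rabs_pos_eq in Huv by exact Hy.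
    unfold Cmult; simpl. f_equal; lra.
  - exists (u, - v). rewrite Rabs_left in Huv by lra.
    unfold Cmult; simpl. f_equal; lra.
Qed.

Lemma Cmult_integral (x y : C) : (x * y)%C = RtoC 0 -> x <> RtoC 0 -> y = RtoC 0.
Proof.
  intros E Hx. rewrite <- (Cmult_1_l y), <- (Cinv_l x Hx), <- Cmult_assoc, E. ring.
Qed.

(** The vector [(b, - p)] is orthogonal to the first row, and to the second by the determinant. If
    it is zero, the second column of the matrix vanishes and [(0, 1)] works. *)
Lemma singular_kernel (p b g : C) :
  (p * p - b * g)%C = RtoC 0 ->
  exists w1 w2 : C, (w1, w2) <> (RtoC 0, RtoC 0) /\
    (p * w1 + b * w2)%C = RtoC 0 /\ (g * w1 + p * w2)%C = RtoC 0.
Proof.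
  intros E. destruct (classic ((b, - p)%C = (RtoC 0, RtoC 0))) as [H0|H0].
  - assert (Hb := f_equal fst H0). assert (Hp := f_equal snd H0). cbn [fst snd] in Hb, Hp.
    exists (RtoC 0), (RtoC 1).
    assert (Hp0 : p = RtoC 0) by (replace p with (- - p)%C by ring; rewrite Hp; ring).
    subst b p. split.
    + intros F. injection F. lra.
    + split; ring.
  - exists b, (- p)%C. split; [exact H0|]. split; [ring|].
    replace (g * b + p * - p)%C with (- (p * p - b * g))%C by ring. rewrite E. ring.
Qed.

Lemma regular_kernel (p b g w1 w2 : C) :
  (p * p - b * g)%C <> RtoC 0 ->
  (p * w1 + b * w2)%C = RtoC 0 -> (g * w1 + p * w2)%C = RtoC 0 ->
  w1 = RtoC 0 /\ w2 = RtoC 0.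
Proof.
  intros Hd E1 E2. split; apply (Cmult_integral _ _) with (2 := Hd).
  - replace ((p * p - b * g) * w1)%C
      with (p * (p * w1 + b * w2) - b * (g * w1 + p * w2))%C by ring.
    rewrite E1, E2. ring.
  - replace ((p * p - b * g) * w2)%C
      with (p * (g * w1 + p * w2) - g * (p * w1 + b * w2))%C by ring.
    rewrite E1, E2. ring.
Qed.

(** Determinant of the operator matrix [[A, B; G, A]], meaningful because the entries commute.
    Writing the minus sign as a scalar factor fits [appr_scal]. *)
Definition opdet (A B G : op) : op := fun x i => (A (A x) i + - (1) * B (G x) i)%C.

Lemma appr_opdet (A B G : op) : appr A -> appr B -> appr G -> appr (opdet A B G).
Proof.
  intros HA HB HG. apply (appr_plus (fun x => A (A x))).
  - now apply appr_comp.
  - apply appr_scal. now apply appr_comp.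
Qed.

Lemma opdet_ech (A B G : op) (t : R) :
  appr A -> appr B -> appr G ->
  opdet A B G (ech t) 0%Z =
  (A (ech t) 0%Z * A (ech t) 0%Z - B (ech t) 0%Z * G (ech t) 0%Z)%C.
Proof.
  intros HA HB HG. unfold opdet. rewrite !appr_comp_ech by assumption. ring.
Qed.

(* Multiply by the adjugate matrix [A, -B; -G, A]. *)
Lemma block_unique (A B G : op) (x1 x2 x1' x2' : Z -> C) (M M' : R) :
  appr A -> appr B -> appr G ->
  (forall x M, bnd x M -> (forall i, opdet A B G x i = RtoC 0) -> forall i, x i = RtoC 0) ->
  bnd x1 M -> bnd x2 M -> bnd x1' M' -> bnd x2' M' ->
  (forall i, (A x1 i + B x2 i)%C = (A x1' i + B x2' i)%C) ->
  (forall i, (G x1 i + A x2 i)%C = (G x1' i + A x2' i)%C) ->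
  x1 = x1' /\ x2 = x2'.
Proof.
  intros HA HB HG Hinj Hx1 Hx2 Hx1' Hx2' E1 E2.
  assert (HD := appr_opdet A B G HA HB HG).
  assert (Sub : forall x y N N', bnd x N -> bnd y N' -> bnd (fun i => (x i - y i)%C) (N + N')).
  { intros x y N N' Hx Hy i. generalize (Cmod_minus_le (x i) (y i)) (Hx i) (Hy i). lra. }
  set (d1 := fun i => (x1 i - x1' i)%C). set (d2 := fun i => (x2 i - x2' i)%C).
  assert (Hd1 : bnd d1 (M + M')) by (now apply Sub).
  assert (Hd2 : bnd d2 (M + M')) by (now apply Sub).
  destruct (appr_bounded A HA) as (KA & _ & BA).
  destruct (appr_bounded B HB) as (KB & _ & BB).
  destruct (appr_bounded G HG) as (KG & _ & BG).
  assert (F1 : (fun i => (A d1 i + B d2 i)%C) = fun _ => RtoC 0).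
  { apply functional_extensionality; intros i. unfold d1, d2.
    rewrite (appr_sub_arg A x1 x1' M M'), (appr_sub_arg B x2 x2' M M') by assumption.
    replace (A x1 i - A x1' i + (B x2 i - B x2' i))%C
      with ((A x1 i + B x2 i) - (A x1' i + B x2' i))%C by ring. rewrite E1. ring. }
  assert (F2 : (fun i => (G d1 i + A d2 i)%C) = fun _ => RtoC 0).
  { apply functional_extensionality; intros i. unfold d1, d2.
    rewrite (appr_sub_arg G x1 x1' M M'), (appr_sub_arg A x2 x2' M M') by assumption.
    replace (G x1 i - G x1' i + (A x2 i - A x2' i))%C
      with ((G x1 i + A x2 i) - (G x1' i + A x2' i))%C by ring. rewrite E2. ring. }
  assert (Lin : forall (T : op) u v N N' i, appr T -> bnd u N -> bnd v N' ->
            (fun i => (u i + v i)%C) = (fun _ => RtoC 0) -> (T u i + T v i)%C = RtoC 0).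
  { intros T u v N N' i HT Hu Hv E.
    rewrite <- (appr_add_arg T u v N N' i HT Hu Hv), E. now apply appr_zero_arg. }
  assert (D1 : forall i, d1 i = RtoC 0).
  { apply (Hinj d1 _ Hd1). intros i. unfold opdet.
    assert (P1 := Lin A _ _ _ _ i HA (BA _ _ Hd1) (BB _ _ Hd2) F1).
    assert (P2 := Lin B _ _ _ _ i HB (BG _ _ Hd1) (BA _ _ Hd2) F2).
    rewrite (appr_comm B A d2 _ i HB HA Hd2) in P2.
    replace (A (A d1) i + - (1) * B (G d1) i)%C
      with ((A (A d1) i + A (B d2) i) - (B (G d1) i + A (B d2) i))%C by ring.
    rewrite P1, P2. ring. }
  assert (D2 : forall i, d2 i = RtoC 0).
  { apply (Hinj d2 _ Hd2). intros i. unfold opdet.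
    assert (P1 := Lin G _ _ _ _ i HG (BA _ _ Hd1) (BB _ _ Hd2) F1).
    assert (P2 := Lin A _ _ _ _ i HA (BG _ _ Hd1) (BA _ _ Hd2) F2).
    rewrite (appr_comm G A d1 _ i HG HA Hd1), (appr_comm G B d2 _ i HG HB Hd2) in P1.
    replace (A (A d2) i + - (1) * B (G d2) i)%C
      with ((A (G d1) i + A (A d2) i) - (A (G d1) i + B (G d2) i))%C by ring.
    rewrite P1, P2. ring. }
  split; apply functional_extensionality; intros i.
  - replace (x1 i) with (d1 i + x1' i)%C by (unfold d1; ring). rewrite D1. ring.
  - replace (x2 i) with (d2 i + x2' i)%C by (unfold d2; ring). rewrite D2. ring.
Qed.

(** Solve the scalar equations [det u = y1] and [det v = y2], then apply the adjugate to
    [(u, v)]. *)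
Lemma block_surjective (A B G : op) (y1 y2 : Z -> C) (M : R) :
  appr A -> appr B -> appr G ->
  (forall y M, bnd y M -> exists x M', bnd x M' /\ forall i, opdet A B G x i = y i) ->
  bnd y1 M -> bnd y2 M ->
  exists x1 x2 M', bnd x1 M' /\ bnd x2 M' /\
    (forall i, (A x1 i + B x2 i)%C = y1 i) /\ (forall i, (G x1 i + A x2 i)%C = y2 i).
Proof.
  intros HA HB HG Hsurj Hy1 Hy2.
  destruct (Hsurj y1 M Hy1) as (u & Mu & Hu & Eu).
  destruct (Hsurj y2 M Hy2) as (v & Mv & Hv & Ev).
  destruct (appr_bounded A HA) as (KA & HKA & BA).
  destruct (appr_bounded B HB) as (KB & HKB & BB).
  destruct (appr_bounded G HG) as (KG & HKG & BG).
  assert (Mu0 := bnd_nonneg _ _ Hu). assert (Mv0 := bnd_nonneg _ _ Hv).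
  set (x1 := fun i => (A u i - B v i)%C). set (x2 := fun i => (A v i - G u i)%C).
  exists x1, x2, (KA * Mu + KB * Mv + KA * Mv + KG * Mu). split; [|split; [|split]]; intros i.
  - unfold x1. generalize (Cmod_minus_le (A u i) (B v i)) (BA _ _ Hu i) (BB _ _ Hv i). nra.
  - unfold x2. generalize (Cmod_minus_le (A v i) (G u i)) (BA _ _ Hv i) (BG _ _ Hu i). nra.
  - rewrite <- Eu. unfold x1, x2, opdet.
    rewrite (appr_sub_arg A _ _ _ _ i HA (BA _ _ Hu) (BB _ _ Hv)).
    rewrite (appr_sub_arg B _ _ _ _ i HB (BA _ _ Hv) (BG _ _ Hu)).
    rewrite (appr_comm B A v _ i HB HA Hv). ring.
  - rewrite <- Ev. unfold x1, x2, opdet.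
    rewrite (appr_sub_arg G _ _ _ _ i HG (BA _ _ Hu) (BB _ _ Hv)).
    rewrite (appr_sub_arg A _ _ _ _ i HA (BA _ _ Hv) (BG _ _ Hu)).
    rewrite (appr_comm G A u _ i HG HA Hu), (appr_comm G B v _ i HG HB Hv). ring.
Qed.

(** * Circulant matrices *)

Lemma csum_cyclic_col (N r : nat) (F : nat -> C) :
  (r < N)%nat -> csum N (fun col => F ((col + N - r) mod N)%nat) = csum N F.
Proof.
  intros Hr. replace N with (r + (N - r))%nat at 1 by lia.
  rewrite csum_add.
  replace (csum N F) with (csum ((N - r) + r) F) by (f_equal; lia).
  rewrite (csum_add (N - r) r F), Cplus_comm. f_equal; apply csum_ext; intros k Hk; f_equal.
  - replace (r + k + N - r)%nat with (k + 1 * N)%nat by lia.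
    rewrite Nat.Div0.mod_add. apply Nat.mod_small. lia.
  - rewrite Nat.mod_small; lia.
Qed.

(** The residue decreases as [r] grows, so the two blocks [r <= col] and [r > col] are each summed
    backwards. *)
Lemma csum_cyclic_row (N col : nat) (F : nat -> C) :
  (col < N)%nat -> csum N (fun r => F ((col + N - r) mod N)%nat) = csum N F.
Proof.
  intros Hc. replace N with ((col + 1) + (N - col - 1))%nat at 1 by lia.
  rewrite csum_add.
  replace (csum N F) with (csum ((col + 1) + (N - col - 1)) F) by (f_equal; lia).
  rewrite (csum_add (col + 1) (N - col - 1) F).
  rewrite (csum_rev (col + 1)), (csum_rev (N - col - 1)).
  f_equal; apply csum_ext; intros k Hk; f_equal.
  - replace (col + N - (col + 1 - 1 - k))%nat with (k + 1 * N)%nat by lia.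
    rewrite Nat.Div0.mod_add. apply Nat.mod_small. lia.
  - rewrite Nat.mod_small; lia.
Qed.

Lemma ech_cyclic (N r col : nat) (t : R) :
  (r < N)%nat -> cis (INR N * t) = RtoC 1 ->
  ech t (Z.of_nat col) = (ech t (Z.of_nat ((col + N - r) mod N)) * ech t (Z.of_nat r))%C.
Proof.
  intros Hr HN. set (m := ((col + N - r) mod N)%nat).
  assert (E : (col + N - r = N * ((col + N - r) / N) + m)%nat) by (apply Nat.div_mod_eq).
  set (k := ((col + N - r) / N)%nat) in E.
  replace (Z.of_nat col)
    with ((Z.of_nat m + Z.of_nat r) + (Z.of_nat k - 1) * Z.of_nat N)%Z by nia.
  rewrite (ech_periodic N) by exact HN.
  unfold ech. rewrite plus_IZR, Rmult_plus_distr_r. apply cis_plus.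
Qed.

Lemma circulant_ech (f : Z -> C) (N r : nat) (t : R) :
  summable f -> (r < N)%nat -> cis (INR N * t) = RtoC 1 ->
  csum N (fun col => (periodize f N (Z.of_nat ((col + N - r) mod N)) * ech t (Z.of_nat col))%C)
  = (symb f t * ech t (Z.of_nat r))%C.
Proof.
  intros Hf Hr HN. rewrite <- (periodize_symb f N t Hf HN) by lia.
  rewrite <- (csum_cyclic_col N r
    (fun n => (periodize f N (Z.of_nat n) * ech t (Z.of_nat n))%C) Hr), Cmult_comm, <- csum_scal.
  apply csum_ext. intros col _. rewrite (ech_cyclic N r col t Hr HN). ring.
Qed.

(** The convolution theorem. The eigenvector statement [circulant_ech] only produces eigenvalues;
    this one shows that there are no others. *)
Lemma circulant_dft (f : Z -> C) (u : nat -> C) (N : nat) (t : R) :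
  summable f -> cis (INR N * t) = RtoC 1 ->
  csum N (fun r => (cis (- (INR r * t)) *
     csum N (fun col => periodize f N (Z.of_nat ((col + N - r) mod N)) * u col))%C)
  = (symb f t * csum N (fun col => cis (- (INR col * t)) * u col))%C.
Proof.
  intros Hf HN. rewrite <- csum_scal.
  rewrite (csum_ext N _ (fun r => csum N (fun col => (cis (- (INR col * t)) * u col *
    (periodize f N (Z.of_nat ((col + N - r) mod N)) *
     ech t (Z.of_nat ((col + N - r) mod N))))%C))).
  - rewrite csum_swap. apply csum_ext. intros col Hc.
    rewrite csum_scal.
    rewrite (csum_cyclic_row N col
      (fun n => (periodize f N (Z.of_nat n) * ech t (Z.of_nat n))%C) Hc).
    rewrite (periodize_symb f N t Hf HN) by lia. ring.
  - intros r Hr. rewrite <- csum_scal. apply csum_ext. intros col Hc.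
    assert (E : cis (- (INR r * t)) =
      (cis (- (INR col * t)) * ech t (Z.of_nat ((col + N - r) mod N)))%C).
    { assert (E := ech_cyclic N r col t Hr HN). unfold ech in E at 1 3.
      rewrite <- !INR_IZR_INZ in E.
      apply (f_equal (fun z => (cis (- (INR r * t)) * cis (- (INR col * t)) * z)%C)) in E.
      rewrite <- Cmult_assoc, (Cmult_comm (cis (- (INR col * t)))), cis_mul_opp in E.
      rewrite Cmult_1_r in E. rewrite E at 1.
      set (z := ech _ _). rewrite <- (Cmult_1_r (_ * z)%C), <- (cis_mul_opp (INR r * t)). ring. }
    rewrite E. ring.
Qed.

(** * Summability of the kernel coefficients *)

(** Discrete form of comparison with the integral of the power: it follows from
    [ln (x + 1) - ln x >= 1 / (x + 1)] and [exp u >= 1 + u]. *)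
Lemma Rpower_telescope (x delta : R) :
  0 < x -> 0 < delta ->
  delta * Rpower (x + 1) (- 1 - delta) <= Rpower x (- delta) - Rpower (x + 1) (- delta).
Proof.
  intros Hx Hd. set (y := x + 1). assert (Hy : 0 < y) by (unfold y; lra).
  assert (E1 : Rpower y (- 1 - delta) = Rpower y (- delta) * / y).
  { replace (- 1 - delta) with (- delta + - (1)) by ring.
    rewrite Rpower_plus, Rpower_Ropp, (Rpower_Ropp y 1), Rpower_1 by exact Hy. reflexivity. }
  assert (E2 : Rpower x (- delta) = Rpower y (- delta) * exp (delta * (ln y - ln x))).
  { unfold Rpower. rewrite <- exp_plus. f_equal. ring. }
  assert (L : / y <= ln y - ln x).
  { assert (H1 := exp_ineq1_le (ln (x / y))).
    assert (Hxy : 0 < x / y) by (apply Rdiv_lt_0_compat; assumption).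
    rewrite exp_ln, ln_div in H1 by assumption.
    assert (x / y = 1 - / y) by (unfold y; field; unfold y in Hy; lra). lra. }
  assert (H2 := exp_ineq1_le (delta * (ln y - ln x))).
  rewrite E1, E2. assert (Hp : 0 < Rpower y (- delta)) by apply exp_pos.
  assert (delta * / y <= delta * (ln y - ln x)) by (apply Rmult_le_compat_l; lra).
  nra.
Qed.

Lemma ex_series_Rpower (delta : R) :
  0 < delta -> ex_series (fun n => Rpower (INR (S n)) (- 1 - delta)).
Proof.
  intros Hd. apply ex_series_bounded with (1 + / delta).
  { intros n. apply Rlt_le, exp_pos. }
  assert (Hi : 0 < / delta) by (now apply Rinv_0_lt_compat).
  assert (Hdi : / delta * delta = 1) by (apply Rinv_l; lra).
  assert (One : forall p, Rpower 1 p = 1)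
    by (intros; unfold Rpower; now rewrite ln_1, Rmult_0_r, exp_0).
  intros n.
  (* Induction needs the telescoped remainder, which the bound [1 + / delta] drops. *)
  enough (G : sum_n (fun n => Rpower (INR (S n)) (- 1 - delta)) n
              <= 1 + / delta * (1 - Rpower (INR (S n)) (- delta))).
  { assert (0 < Rpower (INR (S n)) (- delta)) by apply exp_pos. nra. }
  induction n as [|n IH].
  - rewrite sum_O. simpl INR. rewrite !One. lra.
  - rewrite sum_Sn.
    assert (Hn : 0 < INR (S n)) by (apply lt_0_INR; lia).
    assert (Ht := Rpower_telescope (INR (S n)) delta Hn Hd).
    rewrite <- S_INR in Ht.
    assert (Ht' := Rmult_le_compat_l (/ delta) _ _ (Rlt_le _ _ Hi) Ht).
    rewrite <- Rmult_assoc, Hdi in Ht'.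
    set (p := Rpower (INR (S (S n))) (- 1 - delta)) in *.
    set (s := sum_n _ n) in *.
    change (s + p <= 1 + / delta * (1 - Rpower (INR (S (S n))) (- delta))).
    lra.
Qed.

(** One scalar sequence per matrix entry of the blocks: [s] is [0] on the diagonal, [-2 * a] and
    [2 * a] off it. *)
Definition coef (omega : R -> R) (T c s : R) (k : Z) : C := RtoC (omega (s + IZR k * T) / c).

Lemma summable_coef (omega : R -> R) (T c s C0 delta : R) :
  0 < T -> Rabs s <= T -> 0 < C0 -> 0 < delta ->
  (forall x, Rabs (omega x) <= C0 * Rpower (1 + Rabs x) (- 1 - delta)) ->
  summable (coef omega T c s).
Proof.
  intros HT Hs HC Hd Hdec. set (m := Rmin 1 T).
  assert (Hm : 0 < m) by (apply Rmin_pos; lra).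
  assert (Hm1 : m <= 1) by apply Rmin_l. assert (HmT : m <= T) by apply Rmin_r.
  set (D := C0 * Rpower m (- 1 - delta) * Rabs (/ c)).
  assert (Main : forall u n, INR n * T <= Rabs u ->
            Cmod (RtoC (omega u / c)) <= Rpower (INR (S n)) (- 1 - delta) * D).
  { intros u n Hu. rewrite Cmod_R. unfold Rdiv. rewrite Rabs_mult.
    assert (Hn : 0 < INR (S n)) by (apply lt_0_INR; lia).
    replace (Rpower (INR (S n)) (- 1 - delta) * D)
      with (C0 * (Rpower m (- 1 - delta) * Rpower (INR (S n)) (- 1 - delta)) * Rabs (/ c))
      by (unfold D; ring).
    apply Rmult_le_compat_r; [apply Rabs_pos|].
    eapply Rle_trans; [apply Hdec|]. apply Rmult_le_compat_l; [lra|].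
    rewrite Rpower_mult_distr by assumption.
    replace (- 1 - delta) with (- (1 + delta)) by ring. rewrite !Rpower_Ropp.
    apply Rinv_le_contravar; [apply exp_pos|].
    apply Rle_Rpower_l; [lra|]. split; [nra|]. rewrite S_INR in *.
    generalize (pos_INR n). nra. }
  assert (Hser := ex_series_scal_r D _ (ex_series_Rpower delta Hd)).
  assert (Hs' := Rle_abs s). assert (Hs'' := Rle_abs (- s)). rewrite Rabs_Ropp in Hs''.
  split.
  (* The offset [s] can use up one period: for [k = n + 1] only [s + k T >= n T] is known, so the
     term [k = 0] is set aside. *)
  - apply ex_series_S. eapply ex_series_dominated; [|exact Hser].
    intros n. rewrite Rabs_pos_eq by apply Cmod_ge_0. apply Main.
    rewrite <- INR_IZR_INZ, S_INR. eapply Rle_trans; [|apply Rle_abs]. lra.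
  - eapply ex_series_dominated; [|exact Hser].
    intros n. rewrite Rabs_pos_eq by apply Cmod_ge_0. apply Main.
    rewrite opp_IZR, <- INR_IZR_INZ, S_INR, <- Rabs_Ropp.
    eapply Rle_trans; [|apply Rle_abs]. lra.
Qed.

(** * The spectra of L and of the circulants *)

Lemma coef_0 (omega : R -> R) (T c : R) (k : Z) :
  coef omega T c 0 k = RtoC (omega (IZR k * T) / c).
Proof. unfold coef. now rewrite Rplus_0_l. Qed.

Lemma Series_zero : Series (fun _ : nat => 0) = 0.
Proof.
  rewrite (Series_ext _ (fun _ => 0 * 0)) by (intros; ring).
  rewrite Series_scal_l. apply Rmult_0_l.
Qed.

Lemma omega_p_periodize (omega : R -> R) (T c s : R) (N m : nat) :
  RtoC (omega_p omega (s + INR m * T) (INR N * T) / c)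
  = periodize (coef omega T c s) N (Z.of_nat m).
Proof.
  unfold omega_p, periodize, CZsum, coef, RtoC, Rdiv; simpl. f_equal.
  - unfold Zsum. rewrite !Series_scal_r, <- Rmult_plus_distr_r. f_equal.
    f_equal; apply Series_ext; intros n; f_equal;
      rewrite minus_IZR, mult_IZR, <- !INR_IZR_INZ; ring.
  - unfold Zsum. rewrite Series_zero. ring.
Qed.

Lemma omega_p_periodize_0 (omega : R -> R) (T c : R) (N m : nat) :
  RtoC (omega_p omega (INR m * T) (INR N * T) / c)
  = periodize (coef omega T c 0) N (Z.of_nat m).
Proof. rewrite <- omega_p_periodize. now rewrite Rplus_0_l. Qed.

Lemma fst_vsum (n : nat) (F : nat -> C * C) : fst (vsum n F) = csum n (fun k => fst (F k)).
Proof. induction n as [|n IH]; simpl; [reflexivity|]. now rewrite IH. Qed.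

Lemma snd_vsum (n : nat) (F : nat -> C * C) : snd (vsum n F) = csum n (fun k => snd (F k)).
Proof. induction n as [|n IH]; simpl; [reflexivity|]. now rewrite IH. Qed.

Definition circulant (f : Z -> C) (N : nat) (u : nat -> C) (r : nat) : C :=
  csum N (fun col => (periodize f N (Z.of_nat ((col + N - r) mod N)) * u col)%C).

Lemma circ_apply_circulant (omega : R -> R) (T a c : R) (q : nat) (v : nat -> C * C) (r : nat) :
  let N := S q in
  let A := circulant (coef omega T c 0) N in
  let B := circulant (coef omega T c (-2 * a)) N in
  let G := circulant (coef omega T c (2 * a)) N in
  circ_apply omega T a c q v r =
  ((A (fun k => fst (v k)) r + B (fun k => snd (v k)) r)%C,
   (G (fun k => fst (v k)) r + A (fun k => snd (v k)) r)%C).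
Proof.
  cbv zeta. unfold circ_apply, circulant. rewrite (surjective_pairing (vsum _ _)).
  rewrite fst_vsum, snd_vsum, <- !csum_plus. f_equal; apply csum_ext; intros col _;
    unfold blk; cbn [fst snd]; now rewrite !omega_p_periodize, omega_p_periodize_0.
Qed.

Lemma bdd_seq_bnd (x : Z -> C * C) :
  bdd_seq x -> exists M, bnd (fun i => fst (x i)) M /\ bnd (fun i => snd (x i)) M.
Proof. intros [M HM]. exists M. split; intros i; apply HM. Qed.

Lemma Lop_laurent (omega : R -> R) (T a c : R) (x : Z -> C * C) (i : Z) :
  summable (coef omega T c 0) -> summable (coef omega T c (-2 * a)) ->
  summable (coef omega T c (2 * a)) -> bdd_seq x ->
  let A := laurent (coef omega T c 0) in
  let B := laurent (coef omega T c (-2 * a)) in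
  let G := laurent (coef omega T c (2 * a)) in
  Lop omega T a c x i =
  ((A (fun k => fst (x k)) i + B (fun k => snd (x k)) i)%C,
   (G (fun k => fst (x k)) i + A (fun k => snd (x k)) i)%C).
Proof.
  intros SA SB SG Hx. cbv zeta. destruct (bdd_seq_bnd x Hx) as (M & H1 & H2).
  assert (S : forall f u, summable f -> bnd u M -> summable (fun j => (f (i - j)%Z * u j)%C)).
  { intros f u Hf Hu. apply summable_mult_bnd with M; [now apply summable_reflect|exact Hu]. }
  unfold Lop, laurent. rewrite <- !CZsum_plus by (apply S; assumption).
  f_equal; apply CZsum_ext; intros j; unfold blk; cbn [fst snd]; now rewrite coef_0.
Qed.

Definition symdet (omega : R -> R) (T a c : R) (lam : C) (t : R) : C :=
  let p := (symb (coef omega T c 0) t - lam)%C in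
  (p * p - symb (coef omega T c (-2 * a)) t * symb (coef omega T c (2 * a)) t)%C.

Lemma circ_eigenvalue (omega : R -> R) (T a c : R) (q : nat) (mu : C) (t : R) :
  summable (coef omega T c 0) -> summable (coef omega T c (-2 * a)) ->
  summable (coef omega T c (2 * a)) ->
  cis (INR (S q) * t) = RtoC 1 -> symdet omega T a c mu t = RtoC 0 ->
  in_spectrum_circ omega T a c q mu.
Proof.
  intros SA SB SG Ht Hdet.
  destruct (singular_kernel _ _ _ Hdet) as (w1 & w2 & Hw & E1 & E2).
  exists (fun k => (w1 * ech t (Z.of_nat k), w2 * ech t (Z.of_nat k))%C). split.
  - exists O. split; [lia|]. simpl Z.of_nat. rewrite ech_0, !Cmult_1_r. exact Hw.
  - intros r Hr. rewrite circ_apply_circulant. cbn [fst snd].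
    assert (Ev : forall f w, summable f -> circulant f (S q) (fun k => (w * ech t (Z.of_nat k))%C) r
              = (w * (symb f t * ech t (Z.of_nat r)))%C).
    { intros f w Hf. rewrite <- (circulant_ech f (S q) r t Hf Hr Ht), <- csum_scal.
      apply csum_ext. intros; ring. }
    rewrite !Ev by assumption. unfold vscal; cbn [fst snd].
    set (A := symb _ t) in *. set (B := symb (coef omega T c (-2 * a)) t) in *.
    set (G := symb (coef omega T c (2 * a)) t) in *. set (e := ech t (Z.of_nat r)). f_equal.
    + replace (w1 * (A * e) + w2 * (B * e))%C
        with (((A - mu) * w1 + B * w2) * e + mu * (w1 * e))%C by ring. rewrite E1. ring.
    + replace (w1 * (G * e) + w2 * (A * e))%C
        with ((G * w1 + (A - mu) * w2) * e + mu * (w2 * e))%C by ring. rewrite E2. ring.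
Qed.

(** The Fourier coefficients of an eigenvector lie in the kernels of the matrices [Phi - mu]. Were
    all of these invertible, every coefficient would vanish, and with them the eigenvector. *)
Lemma circ_eigenvalue_symdet (omega : R -> R) (T a c : R) (q : nat) (mu : C) :
  summable (coef omega T c 0) -> summable (coef omega T c (-2 * a)) ->
  summable (coef omega T c (2 * a)) ->
  in_spectrum_circ omega T a c q mu ->
  exists j, (j < S q)%nat /\ symdet omega T a c mu (root_angle (S q) j) = RtoC 0.
Proof.
  intros SA SB SG (v & (r0 & Hr0 & Hv) & Heig). apply NNPP. intros Hno. apply Hv.
  set (N := S q) in *.
  set (hat := fun (u : nat -> C) t => csum N (fun k => (cis (- (INR k * t)) * u k)%C)).
  set (u1 := fun k => fst (v k)). set (u2 := fun k => snd (v k)).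
  assert (Hz : forall j, (j < N)%nat ->
            hat u1 (root_angle N j) = RtoC 0 /\ hat u2 (root_angle N j) = RtoC 0).
  { intros j Hj. set (t := root_angle N j).
    assert (Ht : cis (INR N * t) = RtoC 1) by (apply cis_root_angle; lia).
    assert (Dft : forall f u, summable f ->
              csum N (fun r => (cis (- (INR r * t)) * circulant f N u r)%C)
              = (symb f t * hat u t)%C)
      by (intros; now apply circulant_dft).
    assert (E1 : forall r, (r < N)%nat ->
       (circulant (coef omega T c 0) N u1 r + circulant (coef omega T c (-2 * a)) N u2 r
        = mu * u1 r)%C).
    { intros r Hr. generalize (f_equal fst (Heig r Hr)). now rewrite circ_apply_circulant. }
    assert (E2 : forall r, (r < N)%nat ->
       (circulant (coef omega T c (2 * a)) N u1 r + circulant (coef omega T c 0) N u2 r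
        = mu * u2 r)%C).
    { intros r Hr. generalize (f_equal snd (Heig r Hr)). now rewrite circ_apply_circulant. }
    assert (F1 : (symb (coef omega T c 0) t * hat u1 t
                  + symb (coef omega T c (-2 * a)) t * hat u2 t = mu * hat u1 t)%C).
    { rewrite <- !Dft by assumption. rewrite <- csum_plus. unfold hat. rewrite <- csum_scal.
      apply csum_ext. intros r Hr. rewrite <- Cmult_plus_distr_l, E1 by exact Hr. ring. }
    assert (F2 : (symb (coef omega T c (2 * a)) t * hat u1 t
                  + symb (coef omega T c 0) t * hat u2 t = mu * hat u2 t)%C).
    { rewrite <- !Dft by assumption. rewrite <- csum_plus. unfold hat. rewrite <- csum_scal.
      apply csum_ext. intros r Hr. rewrite <- Cmult_plus_distr_l, E2 by exact Hr. ring. }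
    apply (regular_kernel (symb (coef omega T c 0) t - mu)%C
             (symb (coef omega T c (-2 * a)) t) (symb (coef omega T c (2 * a)) t)).
    - intros E. apply Hno. exists j. split; [exact Hj|exact E].
    - match goal with |- ?l = _ => replace l with
        ((symb (coef omega T c 0) t * hat u1 t
          + symb (coef omega T c (-2 * a)) t * hat u2 t) - mu * hat u1 t)%C by ring end.
      rewrite F1. ring.
    - match goal with |- ?l = _ => replace l with
        ((symb (coef omega T c (2 * a)) t * hat u1 t
          + symb (coef omega T c 0) t * hat u2 t) - mu * hat u2 t)%C by ring end.
      rewrite F2. ring. }
  assert (Inv : forall u : nat -> C,
    (forall j, (j < N)%nat -> hat u (root_angle N j) = RtoC 0) -> u r0 = RtoC 0).
  { intros u Hu. assert (D := dft_inversion N r0 u Hr0).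
    rewrite (csum_ext N _ (fun _ => RtoC 0)), csum_zero in D.
    - apply (Cmult_integral (RtoC (INR N))); [now symmetry|].
      intros E. apply RtoC_inj in E. revert E. apply not_0_INR. unfold N. lia.
    - intros j Hj. fold (hat u (root_angle N j)). rewrite Hu by exact Hj. ring. }
  rewrite (surjective_pairing (v r0)). f_equal.
  - apply (Inv u1). intros j Hj. now apply Hz.
  - apply (Inv u2). intros j Hj. now apply Hz.
Qed.

Definition laurent_sub (f : Z -> C) (lam : C) : op :=
  fun x i => (laurent f x i + - lam * x i)%C.

Lemma appr_laurent_sub (f : Z -> C) (lam : C) : summable f -> appr (laurent_sub f lam).
Proof.
  intros Hf. apply (appr_plus (laurent f)); [now apply appr_laurent|].
  apply (appr_scal (- lam)%C (fun x => x)). exact appr_id.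
Qed.

Definition Ldet (omega : R -> R) (T a c : R) (lam : C) : op :=
  opdet (laurent_sub (coef omega T c 0) lam) (laurent (coef omega T c (-2 * a)))
        (laurent (coef omega T c (2 * a))).

Lemma Ldet_ech (omega : R -> R) (T a c : R) (lam : C) (t : R) :
  summable (coef omega T c 0) -> summable (coef omega T c (-2 * a)) ->
  summable (coef omega T c (2 * a)) ->
  Ldet omega T a c lam (ech t) 0%Z = symdet omega T a c lam (- t).
Proof.
  intros SA SB SG. unfold Ldet.
  rewrite opdet_ech by (auto using appr_laurent_sub, appr_laurent).
  unfold laurent_sub. rewrite !laurent_ech, ech_0 by assumption. unfold symdet. ring.
Qed.

Lemma Lop_vsub (omega : R -> R) (T a c : R) (lam : C) (x : Z -> C * C) (i : Z) :
  summable (coef omega T c 0) -> summable (coef omega T c (-2 * a)) ->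
  summable (coef omega T c (2 * a)) -> bdd_seq x ->
  let A := laurent_sub (coef omega T c 0) lam in
  let B := laurent (coef omega T c (-2 * a)) in
  let G := laurent (coef omega T c (2 * a)) in
  let x1 := fun k => fst (x k) in
  let x2 := fun k => snd (x k) in
  vsub (Lop omega T a c x i) (vscal lam (x i)) =
  ((A x1 i + B x2 i)%C, (G x1 i + A x2 i)%C).
Proof.
  intros SA SB SG Hx. cbv zeta. rewrite Lop_laurent by assumption.
  unfold vsub, vscal, laurent_sub; cbn [fst snd]. f_equal; ring.
Qed.

Lemma spectrum_L_near_circ (omega : R -> R) (T a c : R) (lam : C) (eps : R) :
  summable (coef omega T c 0) -> summable (coef omega T c (-2 * a)) ->
  summable (coef omega T c (2 * a)) -> 0 < eps ->
  in_spectrum_L omega T a c lam ->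
  exists (q : nat) (mu : C), (1 <= q)%nat /\ in_spectrum_circ omega T a c q mu /\
    Cmod (Cminus lam mu) < eps.
Proof.
  intros SA SB SG He Hspec. apply NNPP. intros Hno. apply Hspec. clear Hspec.
  assert (Far : forall q mu, (1 <= q)%nat -> in_spectrum_circ omega T a c q mu ->
            eps <= Cmod (lam - mu)%C).
  { intros q mu Hq Hmu. apply Rnot_lt_le. intros Hlt. apply Hno. now exists q, mu. }
  assert (HA := appr_laurent_sub _ lam SA). assert (HB := appr_laurent _ SB).
  assert (HG := appr_laurent _ SG).
  destruct (wiener (Ldet omega T a c lam) (eps * eps)) as [Hinj Hsurj].
  { now apply appr_opdet. }
  { nra. }
  { intros N j HN. rewrite Ldet_ech by assumption.
    set (t := - root_angle N j).
    assert (Ht : cis (INR N * t) = RtoC 1).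
    { unfold t. rewrite Ropp_mult_distr_r_reverse, cis_opp, cis_root_angle by lia.
      unfold Cconj, RtoC; simpl. f_equal; ring. }
    (* With this root [z], the eigenvalues at [t] are [A + z] and [A - z]; both belong to a
       circulant, so each factor of the determinant is at least [eps] in modulus. *)
    destruct (Csqrt_exists (symb (coef omega T c (-2 * a)) t * symb (coef omega T c (2 * a)) t)%C)
      as [z Hz].
    set (A := symb (coef omega T c 0) t).
    assert (Hev : forall z', (z' * z' = z * z)%C -> eps <= Cmod (lam - (A + z'))%C).
    (* [N]-th roots of unity belong to [q = N - 1], and [2 <= N] gives [1 <= q]. *)
    { intros z' Hz'. apply (Far (N - 1)%nat); [lia|].
      apply circ_eigenvalue with t; try assumption.
      - now replace (S (N - 1)) with N by lia.
      - unfold symdet. fold A. rewrite <- Hz, <- Hz'. ring. }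
    replace (symdet omega T a c lam t) with ((lam - (A + z)) * (lam - (A + - z)))%C.
    - rewrite Cmod_mult. apply Rmult_le_compat; try lra; apply Hev; ring.
    - unfold symdet. fold A. rewrite <- Hz. ring. }
  intros y Hy. destruct (bdd_seq_bnd y Hy) as (M & Hy1 & Hy2).
  destruct (block_surjective _ _ _ _ _ _ HA HB HG Hsurj Hy1 Hy2)
    as (x1 & x2 & M' & Hx1 & Hx2 & E1 & E2).
  assert (Hx : bdd_seq (fun i => (x1 i, x2 i)))
    by (exists M'; intros i; split; [apply Hx1|apply Hx2]).
  exists (fun i => (x1 i, x2 i)). split.
  - split; [exact Hx|]. intros i. rewrite Lop_vsub by assumption. cbn [fst snd].
    rewrite (surjective_pairing (y i)). f_equal; [exact (E1 i)|exact (E2 i)].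
  - intros x' [Hx' Ex']. destruct (bdd_seq_bnd x' Hx') as (M'' & Hx1' & Hx2').
    destruct (block_unique _ _ _ x1 x2 _ _ _ _ HA HB HG Hinj Hx1 Hx2 Hx1' Hx2') as [U1 U2].
    + intros i. rewrite E1. specialize (Ex' i). rewrite Lop_vsub in Ex' by assumption.
      now rewrite <- Ex'.
    + intros i. rewrite E2. specialize (Ex' i). rewrite Lop_vsub in Ex' by assumption.
      now rewrite <- Ex'.
    + apply functional_extensionality; intros i. rewrite U1, U2. symmetry.
      apply surjective_pairing.
Qed.

Lemma root_angle_bound (N j : nat) : (j < N)%nat -> 0 <= root_angle N j <= 2 * PI.
Proof.
  intros Hj. unfold root_angle.
  assert (H1 := pos_INR j). assert (H2 := lt_INR j N Hj). assert (HPI := PI_RGT_0).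
  replace (INR j * (2 * PI / INR N)) with (2 * PI * (INR j / INR N)) by (field; lra).
  assert (0 <= INR j / INR N) by (apply Rdiv_le_0_compat; lra).
  assert (INR j / INR N <= 1) by (apply Rle_div_l; lra).
  split; nra.
Qed.

Lemma symb_bounded (f : Z -> C) : summable f -> exists K, forall t, Cmod (symb f t) <= K.
Proof.
  intros Hf. destruct (appr_bounded _ (appr_laurent f Hf)) as (K & _ & BK).
  exists (K * 1). intros t. rewrite <- (Ropp_involutive t), <- laurent_ech by exact Hf.
  apply BK, ech_bnd.
Qed.

Lemma circ_near_spectrum_L (omega : R -> R) (T a c : R) (lam : C) :
  summable (coef omega T c 0) -> summable (coef omega T c (-2 * a)) ->
  summable (coef omega T c (2 * a)) ->
  (forall eps, 0 < eps -> exists (q : nat) (mu : C),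
     in_spectrum_circ omega T a c q mu /\ Cmod (Cminus lam mu) < eps) ->
  in_spectrum_L omega T a c lam.
Proof.
  intros SA SB SG Hnear Hbij.
  assert (HPI := PI_RGT_0).
  assert (HD : appr (Ldet omega T a c lam))
    by (apply appr_opdet; auto using appr_laurent_sub, appr_laurent).
  (* The interval is negative because [Ldet] at [t] is [symdet] at [- t], while the angles
     [root_angle] lie between [0] and [2 * PI]. *)
  destruct (continuity_ab_min (fun t => Cmod (Ldet omega T a c lam (ech t) 0%Z))
              (- (2 * PI)) 0) as (t & Hmin & _).
  { lra. }
  { intros s _. now apply appr_symbol_continuity. }
  assert (Hzero : symdet omega T a c lam (- t) = RtoC 0).
  { apply Cmod_eq_0, Rle_antisym; [|apply Cmod_ge_0]. rewrite <- Ldet_ech by assumption.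
    destruct (symb_bounded _ SA) as [K HK].
    assert (HK0 : 0 <= K) by (apply Rle_trans with (2 := HK 0); apply Cmod_ge_0).
    assert (Hl := Cmod_ge_0 lam).
    apply le_epsilon. intros eps He. rewrite Rplus_0_l.
    (* The determinants for [lam] and [mu] differ by [(lam - mu) (lam + mu - 2 A)]. The constant
       bounds the second factor, using [|A| <= K] and [|mu| <= |lam| + 1]; the latter is why [mu] is
       also taken within distance [1]. *)
    destruct (small_factor (2 * K + 2 * Cmod lam + 1) eps) as (e & He' & Hs); [lra|exact He|].
    destruct (Hnear (Rmin e 1)) as (q & mu & Hmu & Hd); [apply Rmin_pos; lra|].
    assert (Hd1 := Rmin_l e 1). assert (Hd2 := Rmin_r e 1).
    destruct (circ_eigenvalue_symdet _ _ _ _ _ _ SA SB SG Hmu) as (j & Hj & Ej).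
    set (s := root_angle (S q) j) in *.
    assert (Hsb := root_angle_bound (S q) j Hj). fold s in Hsb.
    eapply Rle_trans; [apply (Hmin (- s)); lra|]. cbv beta.
    rewrite Ldet_ech, Ropp_involutive by assumption.
    replace (symdet omega T a c lam s)
      with ((lam - mu) * (lam + mu - 2 * symb (coef omega T c 0) s))%C.
    - rewrite Cmod_mult.
      assert (Hmu' : Cmod mu <= Cmod lam + 1).
      { replace mu with (lam - (lam - mu))%C by ring.
        generalize (Cmod_minus_le lam (lam - mu)%C). lra. }
      assert (Hf : Cmod (lam + mu - 2 * symb (coef omega T c 0) s)%C <= 2 * K + 2 * Cmod lam + 1).
      { eapply Rle_trans; [apply Cmod_minus_le|].
        rewrite Cmod_mult, Cmod_R, Rabs_pos_eq by lra.
        generalize (Cmod_triangle lam mu) (HK s). lra. }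
      apply Rle_trans with (2 := Hs).
      apply Rmult_le_compat; try apply Cmod_ge_0; [lra|exact Hf].
    - transitivity (symdet omega T a c lam s - symdet omega T a c mu s)%C.
      + unfold symdet. ring.
      + rewrite Ej. ring. }
  destruct (singular_kernel _ _ _ Hzero) as (w1 & w2 & Hw & E1 & E2).
  set (x := fun i => (w1 * ech t i, w2 * ech t i)%C).
  assert (Hx : bdd_seq x).
  { exists (Cmod w1 + Cmod w2). intros i. unfold x; cbn [fst snd]. rewrite !Cmod_mult.
    assert (H1 : Cmod (ech t i) = 1) by apply Cmod_cis. rewrite H1.
    generalize (Cmod_ge_0 w1) (Cmod_ge_0 w2). lra. }
  set (z := fun _ : Z => (RtoC 0, RtoC 0)).
  assert (Hz : bdd_seq z).
  { exists 0. intros i. unfold z; cbn [fst snd]. rewrite Cmod_0. lra. }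
  assert (HA := appr_laurent_sub _ lam SA). assert (HB := appr_laurent _ SB).
  assert (HG := appr_laurent _ SG).
  (* Uniqueness fails for the right-hand side zero: both the kernel vector [x] and the zero sequence
     solve the equation. *)
  destruct (Hbij z Hz) as (x0 & _ & Huniq).
  assert (X1 : x0 = x).
  { apply Huniq. split; [exact Hx|]. intros i. rewrite Lop_vsub by assumption.
    unfold x, z; cbn [fst snd].
    rewrite !(appr_scal_arg _ _ (ech t) 1 i) by (try apply ech_bnd; assumption).
    rewrite !(appr_ech _ t i) by assumption.
    unfold laurent_sub. rewrite !laurent_ech, ech_0 by assumption. f_equal.
    - rewrite <- (Cmult_0_l (ech t i)), <- E1. ring.
    - rewrite <- (Cmult_0_l (ech t i)), <- E2. ring. }
  assert (X2 : x0 = z).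
  { apply Huniq. split; [exact Hz|]. intros i. rewrite Lop_vsub by assumption.
    unfold z; cbn [fst snd]. rewrite !appr_zero_arg by assumption. f_equal; ring. }
  rewrite X1 in X2. apply Hw. apply (f_equal (fun f => f 0%Z)) in X2.
  unfold x, z in X2. rewrite ech_0, !Cmult_1_r in X2. exact X2.
Qed.

Theorem theorem4
  (omega : R -> R)
  (* (i) even *)
  (Heven : forall x, omega (- x) = omega x)
  (* (ii) decay *)
  (Hlim : filterlim omega (Rbar_locally p_infty) (locally 0) /\
          filterlim omega (Rbar_locally m_infty) (locally 0))
  (Hdecay : exists C0 delta : R, 0 < C0 /\ 0 < delta /\
              forall x, Rabs (omega x) <= C0 * Rpower (1 + Rabs x) (- 1 - delta))
  (* (iii) bounded, Lipschitz, integrable *)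
  (Hbdd : exists M : R, forall x, Rabs (omega x) <= M)
  (Hlip : exists K : R, forall x y, Rabs (omega x - omega y) <= K * Rabs (x - y))
  (Hint : ex_RInt_gen (fun x => Rabs (omega x)) (Rbar_locally m_infty) (Rbar_locally p_infty))
  (* (iv) positive mass *)
  (Hpos : exists I : R, is_RInt_gen omega (Rbar_locally m_infty) (Rbar_locally p_infty) I
                        /\ 0 < I)
  (h T a : R) (up : R -> R)
  (HT : 0 < T)
  (Ha : 0 < a /\ a < T / 2)
  (* up is continuous, T-periodic, bounded, with bounded continuous derivative *)
  (Hcont : forall x, continuous up x)
  (Hper : forall x, up (x + T) = up x)
  (Hubdd : exists M : R, forall x, Rabs (up x) <= M)
  (Hder : forall x, ex_derive up x)
  (Hdcont : forall x, continuous (Derive up) x)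
  (Hdbdd : exists M : R, forall x, Rabs (Derive up x) <= M)
  (* regular 1-bump shape, threshold h *)
  (Hpa : up a = h) (Hma : up (- a) = h)
  (Hin : forall x, - a < x < a -> up x > h)
  (Hout : forall x, - T / 2 <= x <= T / 2 -> ~ (- a <= x <= a) -> up x < h)
  (Hdpa : Derive up a <> 0) (Hdma : Derive up (- a) <> 0)
  (* up solves the integral equation *)
  (Hsol : forall x, is_RInt_gen (fun y => omega (x - y) * H (up y - h))
                      (Rbar_locally m_infty) (Rbar_locally p_infty) (up x)) :
  forall lam : C,
    in_spectrum_L omega T a (Rabs (Derive up a)) lam <->
    (forall eps : R, 0 < eps ->
       exists (q : nat) (mu : C), (1 <= q)%nat /\
         in_spectrum_circ omega T a (Rabs (Derive up a)) q mu /\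
         Cmod (Cminus lam mu) < eps).
Proof.
  destruct Hdecay as (C0 & delta & HC0 & Hdelta & Hdec).
  assert (Hs : forall s, Rabs s <= T -> summable (coef omega T (Rabs (Derive up a)) s))
    by (intros s Hs; now apply summable_coef with C0 delta).
  assert (SA := Hs 0 ltac:(rewrite Rabs_R0; lra)).
  (* The condition [a < T / 2] keeps the offsets [-2 * a] and [2 * a] within one period. *)
  assert (SB := Hs (-2 * a) ltac:(rewrite Rabs_left; lra)).
  assert (SG := Hs (2 * a) ltac:(rewrite Rabs_pos_eq; lra)).
  intros lam. split.
  - intros Hlam eps Heps. now apply spectrum_L_near_circ.
  - intros Hnear. apply circ_near_spectrum_L; try assumption.
    intros eps Heps. destruct (Hnear eps Heps) as (q & mu & _ & Hmu & Hd). now exists q, mu.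
Qed.
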